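(* Let $\tau$ be any ergodic measure-preserving transformation of a non-atomic probability space $(X,m)$. Given a non-decreasing sequence $(n_k)_{k\ge1}$ of positive integers, the following are equivalent: (a) the series $\sum_{k=1}^\infty \left(M_{n_{k+1}}f-M_{n_k}f\right)$ is unconditionally convergent in $L^2(X,m)$ for all $f\in L^2(X,m)$; (b) $\displaystyle\sup_{|\gamma|=1}\sum_{k=1}^\infty\left|m_{n_{k+1}}(\gamma)-m_{n_k}(\gamma)\right|<\infty$.
   Context: $M_nf=\frac1n\sum_{k=1}^n f\circ\tau^k$ is the usual ergodic average. For $\gamma\in\mathbb{C}$ with $|\gamma|=1$, $m_n(\gamma)=\frac1n\sum_{k=1}^n\gamma^k$. A series $\sum_{k=1}^\infty f_k$ in a Banach space is unconditionally convergent if $\sum_{k=1}^\infty f_{\pi(k)}$ converges in norm for every permutation $\pi$ of $\{1,2,3,\dots\}$. *)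

(* Defs.v *)
From HB Require Import structures.
From mathcomp Require Import all_boot all_order all_algebra.
From mathcomp Require Import all_classical all_reals all_analysis.
From mathcomp Require Import complex.

Set Implicit Arguments.
Unset Strict Implicit.
Unset Printing Implicit Defensive.
Import Order.TTheory GRing.Theory Num.Theory.
Import numFieldNormedType.Exports.
Local Open Scope classical_set_scope.
Local Open Scope ring_scope.

(* The real-valued modulus of a complex number ([`|z|] has type [R[i]]). *)
Definition cabs (R : realType) (z : R[i]) : R := ComplexField.Normc.normc z.

Definition nonatomic d (X : measurableType d) (R : realType)
    (m : {measure set X -> \bar R}) : Prop :=
  forall A, measurable A -> (0 < m A)%E ->
    exists B, [/\ measurable B, B `<=` A, (0 < m B)%E & (m B < m A)%E].

Definition measure_preserving d (X : measurableType d) (R : realType)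
    (m : {measure set X -> \bar R}) (tau : X -> X) : Prop :=
  measurable_fun setT tau /\
  forall A, measurable A -> m (tau @^-1` A) = m A.

Definition ergodic d (X : measurableType d) (R : realType)
    (m : probability X R) (tau : X -> X) : Prop :=
  forall A, measurable A -> tau @^-1` A = A -> m A = 0%E \/ m A = 1%E.

(* Complex L^2(X,m), handled through representatives: the library has neither
   a measurable structure on [R[i]] nor a norm on its quotient spaces of
   a.e.-equal functions, so measurability is that of the real and imaginary
   parts, and norm convergence is expressed with the L^2 seminorm. *)
Definition L2norm d (X : measurableType d) (R : realType)
    (m : {measure set X -> \bar R}) (f : X -> R[i]) : \bar R :=
  ('N[m]_2%:E[(fun x => (cabs (f x))%:E)])%E.

Definition inL2 d (X : measurableType d) (R : realType)
    (m : {measure set X -> \bar R}) (f : X -> R[i]) : Prop :=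
  [/\ measurable_fun setT (fun x => complex.Re (f x)),
      measurable_fun setT (fun x => complex.Im (f x)) &
      (L2norm m f < +oo)%E].

Definition L2_convergent_series d (X : measurableType d) (R : realType)
    (m : {measure set X -> \bar R}) (u : nat -> X -> R[i]) : Prop :=
  exists2 g : X -> R[i], inL2 m g &
    L2norm m (fun x => \sum_(0 <= k < N) u k x - g x) @[N --> \oo] --> 0%E.

Definition L2_unconditionally_convergent d (X : measurableType d)
    (R : realType) (m : {measure set X -> \bar R}) (u : nat -> X -> R[i]) :
    Prop :=
  forall pi : nat -> nat, bijective pi -> L2_convergent_series m (u \o pi).

Definition ergodic_average (X : Type) (R : realType) (tau : X -> X) (n : nat)
    (f : X -> R[i]) : X -> R[i] :=
  fun x => n%:R^-1 * \sum_(1 <= k < n.+1) f (iter k tau x).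

Definition power_average (R : realType) (n : nat) (gamma : R[i]) : R[i] :=
  n%:R^-1 * \sum_(1 <= k < n.+1) gamma ^+ k.

(* Main.v *)
Require Import Defs.
From mathcomp Require Import all_boot all_order all_algebra.
From mathcomp Require Import all_classical all_reals all_analysis.
From mathcomp Require Import measurable_realfun.
From mathcomp Require Import complex separable cyclic cyclotomic zify ring lra.
Import Order.TTheory GRing.Theory Num.Theory.
Import numFieldNormedType.Exports.
Local Open Scope classical_set_scope.
Local Open Scope ring_scope.

(** Why the theorem is true.  Let U be the isometry f |-> f \o tau of L^2 and
let p_k be the polynomial with p_k(U) = M_(n_(k+1)) - M_(n_k), so that
p_k(gamma) = m_(n_(k+1))(gamma) - m_(n_k)(gamma).  Both directions compare the
operators q(U) with the functions q on the unit circle, and the spectral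
theorem is replaced by two elementary estimates.

The first is the inequality of von Neumann for an isometry: if |q| <= B on the
circle then |q(U) f| <= B |f| ([von_neumann_inequality]).  On an orbit, q(U)
acts as a finite Toeplitz matrix on the sequence f(tau^j x), and such a matrix
is bounded by sup |q| because of the Parseval identity over roots of unity
([poly_parseval], [toeplitz_bound]).  Integrating over X and letting the length
of the orbit tend to infinity gives the claim.

The second is the converse: if |q(U) f| <= B |f| for all f then |q| <= B on the
circle ([polyact_bound_circle]).  Since m is non-atomic and tau ergodic, there
are arbitrarily long towers, that is, sets of positive measure whose first L
preimages are disjoint ([tower_base]).  The function equal to gamma^(-j) on the
j-th floor satisfies q(U) f = q(gamma) f on all floors but a number of them
that depends only on the degree of q, a negligible part of a tall tower.

From (b) to (a): by the first estimate all sums of the c_k p_k(U) f with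
|c_k| <= 1 are bounded by sup_gamma (sum |p_k(gamma)|) |f|, whatever the order
of the terms.  In a Hilbert space this forces convergence: if the partial sums
were not Cauchy there would be infinitely many disjoint blocks of norm at least
e, and the parallelogram law would provide signs for which the squared norm of
the signed sum of M blocks is at least M e^2 ([bounded_multipliers_cauchy]).

From (a) to (b): unconditional convergence bounds, for each f, the sums of
p_k(U) f over all finite sets of indices ([unconditional_bounded_subsums]); by
uniform boundedness ([uniform_boundedness]) these finite sums of operators are
bounded in norm by one B, hence so are the finite sums of the p_k on the circle
by the second estimate, and |p_0(gamma)| + ... + |p_N(gamma)| <= 4 B follows by
splitting real and imaginary parts according to their signs. *)

(** * Polynomials evaluated along a sequence *)

(** The linear form on polynomials that sends 'X^k to [a k].  Evaluation at z is
the case a k = z ^ k, and the value at x of p(U) f, for the composition operator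
U f = f \o tau, is the case a k = f (tau^k x): an operator identity between
averages and an identity between their symbols are then the same computation. *)
Definition seqval {C : nzRingType} (a : nat -> C) (p : {poly C}) : C :=
  \sum_(i < size p) p`_i * a i.

Lemma seqval_widen {C : nzRingType} (a : nat -> C) (p : {poly C}) K :
  (size p <= K)%N -> seqval a p = \sum_(i < K) p`_i * a i.
Proof.
move=> pK; rewrite /seqval (big_ord_widen K (fun i => p`_i * a i)) //.
rewrite [RHS](bigID (fun i : 'I_K => (i < size p)%N)) /= [X in _ + X]big1 ?addr0 //.
by move=> i; rewrite -leqNgt => pi; rewrite nth_default ?mul0r.
Qed.

Lemma seqvalD {C : nzRingType} (a : nat -> C) (p q : {poly C}) :
  seqval a (p + q) = seqval a p + seqval a q.
Proof.
rewrite !(seqval_widen a _ (maxn (size p) (size q))) ?leq_maxl ?leq_maxr //.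
  by rewrite -big_split; apply: eq_bigr => i _; rewrite /= coefD mulrDl.
exact: size_polyD.
Qed.

Lemma seqvalZ {C : nzRingType} (a : nat -> C) c (p : {poly C}) :
  seqval a (c *: p) = c * seqval a p.
Proof.
rewrite !(seqval_widen a _ (size p)) ?size_scale_leq //.
by rewrite mulr_sumr; apply: eq_bigr => i _; rewrite coefZ mulrA.
Qed.

Lemma seqvalB {C : nzRingType} (a : nat -> C) (p q : {poly C}) :
  seqval a (p - q) = seqval a p - seqval a q.
Proof. by rewrite seqvalD -[- q]scaleN1r seqvalZ mulN1r. Qed.

Lemma seqval_sum {C : nzRingType} (a : nat -> C) I (r : seq I) (P : pred I)
    (F : I -> {poly C}) :
  seqval a (\sum_(i <- r | P i) F i) = \sum_(i <- r | P i) seqval a (F i).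
Proof.
elim/big_rec2: _ => [|i x p _ <-]; last exact: seqvalD.
by rewrite /seqval size_poly0 big_ord0.
Qed.

Lemma seqvalXn {C : nzRingType} (a : nat -> C) k : seqval a 'X^k = a k.
Proof.
rewrite (seqval_widen a _ k.+1) ?size_polyXn // big_ord_recr /= big1 => [|i _].
  by rewrite coefXn eqxx mul1r add0r.
by rewrite coefXn ltn_eqF ?mul0r.
Qed.

(** * Parseval over roots of unity and the Toeplitz bound *)

(** 'X^n - 1 is separable, so it has n distinct roots, and a finite group of n
roots of unity in a field is cyclic. *)
Lemma prim_root_exists (F : closedFieldType) n :
  n%:R != 0 :> F -> {z : F | n.-primitive_root z}.
Proof.
move=> n0; have n_gt0 : (0 < n)%N by case: n n0 => //; rewrite eqxx.
pose p : {poly F} := 'X^n - 1; have [r Dp] := closed_field_poly_normal p.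
apply/sigW; rewrite (monicP _) ?monicXnsubC // scale1r in Dp.
have rn1 : all n.-unity_root r.
  by apply/allP => z; rewrite -root_prod_XsubC -Dp.
have sz_r : (n < (size r).+1)%N.
  by rewrite -(size_prod_XsubC r id) -Dp size_XnsubC.
have [|z] := hasP (has_prim_root n_gt0 rn1 _ sz_r); last by exists z.
by rewrite -separable_prod_XsubC -Dp separable_Xn_sub_1.
Qed.

(** The L-th roots of unity play the role of the circle: the characters
t |-> w ^ (i t) with i < L are orthogonal because the sum of the powers of a
nontrivial L-th root of unity vanishes. *)
Lemma poly_parseval (C : numClosedFieldType) (w : C) L (p : {poly C}) :
  L.-primitive_root w -> (size p <= L)%N ->
  \sum_(t < L) `|p.[w ^+ t]| ^+ 2 = L%:R * \sum_(i < L) `|p`_i| ^+ 2.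
Proof.
move=> wP pL; have L0 := prim_order_gt0 wP.
have w1 : `|w| = 1.
  apply/eqP; rewrite -(pexpr_eq1 (n := L)) // -normrX.
  by rewrite (prim_expr_order wP) normr1.
have wV : w^* = w^-1 by rewrite invC_norm w1 expr1n invr1 mul1r.
have w0 : w != 0 by rewrite -normr_eq0 w1 oner_neq0.
under eq_bigr => t _.
  rewrite normCK (horner_coef_wide _ pL) rmorph_sum mulr_suml.
  under eq_bigr => i _ do rewrite mulr_sumr.
  over.
rewrite exchange_big mulr_sumr; apply: eq_bigr => i _ /=.
rewrite exchange_big (bigD1 i) //= [X in _ + X]big1 ?addr0 => [|j ji].
  rewrite (eq_bigr (fun=> `|p`_i| ^+ 2)) => [|t _].
    by rewrite sumr_const card_ord mulr_natl.
  by rewrite -normCK normrM !normrX w1 !expr1n mulr1.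
pose z := w ^+ i / w ^+ j.
have z1 : z != 1.
  rewrite /z -(inj_eq (mulIf (expf_neq0 j w0))) mulfVK ?expf_neq0 // mul1r.
  by rewrite (eq_prim_root_expr wP) !modn_small // eq_sym.
rewrite (eq_bigr (fun t : 'I_L => p`_i * (p`_j)^* * z ^+ t)) => [|t _].
  rewrite -mulr_sumr; have /eqP := subrX1 z L.
  rewrite /z expr_div_n -!exprM ![(_ * L)%N]mulnC !exprM (prim_expr_order wP).
  rewrite !expr1n divr1 subrr eq_sym mulf_eq0 subr_eq0 (negbTE z1) /=.
  by move=> /eqP ->; rewrite mulr0.
rewrite rmorphM !rmorphXn /= wV /z !expr_div_n !exprVn -!exprM.
by rewrite !(mulnC t) mulrACA.
Qed.

(** The sums on the left are coefficients of p * A, where A lists the numbers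
[a j] backwards, so that convolution becomes correlation.  By Parseval, multiplying
by p costs at most the factor B in the l^2 norm of the coefficients.  The window
has length N + K on the right since a coefficient of index j < N only involves
a j, ..., a (j + K - 1). *)
Lemma toeplitz_bound (C : numClosedFieldType) (p : {poly C}) (B : C)
    (a : nat -> C) N K :
  (size p <= K)%N -> (forall z, `|z| = 1 -> `|p.[z]| <= B) ->
  \sum_(j < N) `|seqval (fun k => a (j + k)%N) p| ^+ 2
    <= B ^+ 2 * \sum_(j < N + K) `|a j| ^+ 2.
Proof.
move=> pK pB; set M := (N + K)%N.
pose A : {poly C} := \poly_(i < M) a (M.-1 - i)%N.
have B0 : 0 <= B by apply: le_trans (pB 1 _); rewrite ?normr1.
(* Any L at least the size of p * A would do. *)
pose L := (M + M).+1.
have sA : (size A <= M)%N := size_poly _ _.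
have spA : (size (p * A)%R <= L)%N.
  rewrite (leq_trans (size_polyMleq _ _)) // (leq_trans (leq_pred _)) //.
  by rewrite leqW // leq_add // (leq_trans pK) // leq_addl.
have [w wP] := @prim_root_exists C L (lt0r_neq0 (ltr0Sn _ _)).
have L0 : 0 < L%:R :> C := ltr0Sn _ _.
have w1 : `|w| = 1.
  apply/eqP; rewrite -(pexpr_eq1 (n := L)) // -normrX.
  by rewrite (prim_expr_order wP) normr1.
have bnd : \sum_(i < L) `|(p * A)`_i| ^+ 2 <= B ^+ 2 * \sum_(i < L) `|A`_i| ^+ 2.
  rewrite -(ler_pM2l L0) mulrCA -!(poly_parseval _ _ _ _ wP) //; last first.
    by rewrite (leq_trans sA) // leqW // leq_addr.
  rewrite mulr_sumr ler_sum // => t _; rewrite hornerM normrM exprMn.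
  rewrite ler_wpM2r ?exprn_ge0 // lerXn2r ?nnegrE // pB //.
  by rewrite normrX w1 expr1n.
apply: le_trans (le_trans bnd _).
  have NL : (N <= M)%N := leq_addr _ _.
  have ML : (M <= L)%N by rewrite leqW // leq_addr.
  rewrite (big_ord_widen M (fun j =>
    `|seqval (fun k => a (j + k)%N) p| ^+ 2)) //.
  rewrite big_mkcond (reindex_inj rev_ord_inj) /=.
  rewrite (big_ord_widen L (fun i => if (M - i.+1 < N)%N then
    `|seqval (fun k => a (M - i.+1 + k)%N) p| ^+ 2 else 0)) //.
  rewrite big_mkcond /= ler_sum // => i _; case: ifP => iM; last exact: exprn_ge0.
  case: ifP => iN; last exact: exprn_ge0.
  rewrite lerXn2r ?nnegrE // le_eqVlt; apply/orP; left; apply/eqP; congr `|_|.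
  have Ki : (K <= i.+1)%N.
    by move: iN iM; rewrite /M; lia.
  rewrite coefM (seqval_widen _ _ _ (leq_trans pK Ki)); apply: eq_bigr => k _.
  rewrite coef_poly; have ki : (k <= i)%N by rewrite -ltnS.
  rewrite (leq_ltn_trans (leq_subr _ _) iM); congr (_ * a _).
  by move: iM; lia.
rewrite ler_wpM2l ?exprn_ge0 // le_eqVlt; apply/orP; left; apply/eqP.
rewrite [RHS](reindex_inj rev_ord_inj) /=.
rewrite [in RHS](big_ord_widen L (fun i => `|a (M - i.+1)%N| ^+ 2)); last first.
  by rewrite leqW // leq_addr.
rewrite [RHS]big_mkcond; apply: eq_bigr => i _; rewrite coef_poly /=.
by case: ifP => // _; rewrite ?normr0 ?expr0n // -subn1 -subnDA add1n.
Qed.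

(** * The modulus of a complex number *)

Lemma cabs_ge0 {R : realType} (z : R[i]) : 0 <= cabs z.
Proof. by case: z => a b; exact: sqrtr_ge0. Qed.

Lemma cabsE {R : realType} (z : R[i]) : (cabs z)%:C%C = `|z|.
Proof. by case: z. Qed.

Lemma cabs1 {R : realType} : cabs (1 : R[i]) = 1.
Proof. exact: ComplexField.Normc.normc1. Qed.

Lemma cabs0 {R : realType} : cabs (0 : R[i]) = 0.
Proof. exact: ComplexField.Normc.normc0. Qed.

Lemma cabsN {R : realType} (z : R[i]) : cabs (- z) = cabs z.
Proof. exact: normcN. Qed.

Lemma cabsD {R : realType} (y z : R[i]) : cabs (y + z) <= cabs y + cabs z.
Proof. exact: le_normcD. Qed.

Lemma cabsM {R : realType} (y z : R[i]) : cabs (y * z) = cabs y * cabs z.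
Proof. exact: ComplexField.Normc.normcM. Qed.

Lemma cabs_sum {R : realType} I (r : seq I) (P : pred I) (F : I -> R[i]) :
  cabs (\sum_(i <- r | P i) F i) <= \sum_(i <- r | P i) cabs (F i).
Proof.
elim/big_rec2: _ => [|i x y _ xy]; first by rewrite cabs0.
by rewrite (le_trans (cabsD _ _)) // lerD2l.
Qed.

Lemma cabs_real {R : realType} (x : R) : 0 <= x -> cabs x%:C%C = x.
Proof. by move=> x0; apply: complexI; rewrite cabsE ger0_norm // ler0c. Qed.

(** * Series and operators in a space with a Hilbert seminorm *)

(** The vectors of finite norm are given by a predicate [P] on a larger module, and
[q] is only a seminorm: this is the shape of L^2 when it consists of functions and
not of classes of functions.  The parallelogram law stands in for the inner
product. *)
Record hilbert_seminorm {R : realType} {V : lmodType R[i]}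
    (P : V -> Prop) (q : V -> R) : Prop := HilbertSeminorm {
  hs_memD : forall x y, P x -> P y -> P (x + y) ;
  hs_memZ : forall c x, P x -> P (c *: x) ;
  hs_ge0 : forall x, 0 <= q x ;
  hs_normZ : forall c x, P x -> q (c *: x) = cabs c * q x ;
  hs_normD : forall x y, P x -> P y -> q (x + y) <= q x + q y ;
  hs_parallelogram : forall x y, P x -> P y ->
    q (x + y) ^+ 2 + q (x - y) ^+ 2 = 2 * q x ^+ 2 + 2 * q y ^+ 2 }.

Arguments hs_memD {R V P q}.
Arguments hs_memZ {R V P q}.
Arguments hs_ge0 {R V P q}.
Arguments hs_normZ {R V P q}.
Arguments hs_normD {R V P q}.
Arguments hs_parallelogram {R V P q}.

Definition seminorm_cauchy {R : realType} {V : lmodType R[i]} (q : V -> R)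
    (s : nat -> V) : Prop :=
  forall e, 0 < e -> exists N, forall i j, (N <= i)%N -> (i <= j)%N ->
    q (s j - s i) <= e.

Definition seminorm_complete {R : realType} {V : lmodType R[i]}
    (P : V -> Prop) (q : V -> R) : Prop :=
  forall s, (forall k, P (s k)) -> seminorm_cauchy q s ->
  exists2 g, P g & forall e, 0 < e -> exists N, forall i, (N <= i)%N ->
    q (s i - g) <= e.

Section HilbertSeminorm.
Context {R : realType} {V : lmodType R[i]} {P : V -> Prop} {q : V -> R}.
Hypothesis H : hilbert_seminorm P q.

Lemma hs_memN x : P x -> P (- x).
Proof. by rewrite -scaleN1r; exact: (hs_memZ H). Qed.

Lemma hs_memB x y : P x -> P y -> P (x - y).
Proof. by move=> Px Py; apply: (hs_memD H) => //; exact: hs_memN. Qed.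

Lemma hs_normN x : P x -> q (- x) = q x.
Proof. by move=> Px; rewrite -scaleN1r (hs_normZ H) // cabsN cabs1 mul1r. Qed.

Lemma hs_mem0 x : P x -> P 0.
Proof. by rewrite -(scale0r x); exact: (hs_memZ H). Qed.

Lemma hs_norm0 x : P x -> q 0 = 0.
Proof. by move=> Px; rewrite -(scale0r x) (hs_normZ H) // cabs0 mul0r. Qed.

Lemma hs_mem_sum x I (r : seq I) (S : pred I) (F : I -> V) :
  P x -> (forall i, P (F i)) -> P (\sum_(i <- r | S i) F i).
Proof.
move=> Px PF; elim/big_ind: _ => //; first exact: hs_mem0 Px.
by move=> y z; exact: (hs_memD H).
Qed.

Lemma hs_norm_sum x I (r : seq I) (S : pred I) (F : I -> V) :
  P x -> (forall i, P (F i)) ->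
  q (\sum_(i <- r | S i) F i) <= \sum_(i <- r | S i) q (F i).
Proof.
move=> Px PF; elim: r => [|i r IH]; first by rewrite !big_nil (hs_norm0 _ Px).
rewrite !big_cons; case: ifP => // _.
rewrite (le_trans (hs_normD H _ _ _ _)) ?lerD2l //.
exact: hs_mem_sum Px _.
Qed.

(** If the partial sums were not Cauchy, there would be blocks of norm more than e
arbitrarily far out.  Adding one more block y to a sum x with multipliers, one of
x + y and x - y has squared norm at least |x|^2 + |y|^2 by the parallelogram law,
so M blocks would yield multipliers with squared norm at least M e^2, beyond any
bound.  Multipliers equal to 0 skip the terms between two blocks. *)
Lemma bounded_multipliers_cauchy (u : nat -> V) (B : R) :
  (forall k, P (u k)) ->
  (forall N (c : nat -> R[i]), (forall k, cabs (c k) <= 1) ->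
     q (\sum_(0 <= k < N) c k *: u k) <= B) ->
  seminorm_cauchy q (fun N => \sum_(0 <= k < N) u k).
Proof.
move=> Pu uB e e0; apply: contrapT => /forallNP nC.
have far N : exists i j, [/\ (N <= i)%N, (i <= j)%N &
    e < q (\sum_(i <= k < j) u k)].
  have /existsNP[i /existsNP[j]] := nC N.
  move=> /not_implyP[Ni /not_implyP[ij /negP]]; rewrite -ltNge => qe.
  exists i, j; split => //; move: qe.
  by rewrite (big_cat_nat (n := i)) //= addrAC subrr add0r.
have Psum a b c : P (\sum_(a <= k < b) c k *: u k).
  by apply: (hs_mem_sum _ _ _ _ _ (Pu 0%N)) => k; exact: (hs_memZ H).
have grow M : exists N c, (forall k, cabs (c k) <= 1) /\
    M%:R * e ^+ 2 <= q (\sum_(0 <= k < N) c k *: u k) ^+ 2.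
  elim: M => [|M [N [c [c1 Mc]]]].
    exists 0%N, (fun=> 0); split=> [k|]; first by rewrite cabs0 ler01.
    by rewrite mul0r sqr_ge0.
  have [i [j [Ni ij qij]]] := far N.
  set x := (X in q X) in Mc; pose y := \sum_(i <= k < j) u k.
  have Px : P x by exact: Psum.
  have Py : P y by apply: (hs_mem_sum _ _ _ _ _ (Pu 0%N)).
  have ey : e ^+ 2 <= q y ^+ 2.
    by rewrite lerXn2r ?nnegrE ?(hs_ge0 H) ?(ltW e0) // ltW.
  pose c' (s : R[i]) k := if (k < N)%N then c k else if (k < i)%N then 0 else s.
  have sumE s : \sum_(0 <= k < j) c' s k *: u k = x + s *: y.
    rewrite (big_cat_nat (n := N)) ?(leq_trans Ni) //=; congr (_ + _).
      by apply: eq_big_nat => k /andP[_ kN]; rewrite /c' kN.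
    rewrite (big_cat_nat (n := i)) //= big_nat_cond big1 ?add0r.
      rewrite scaler_sumr; apply: eq_big_nat => k /andP[ik _].
      by rewrite /c' !ltnNge (leq_trans Ni ik) ik.
    by move=> k /andP[/andP[Nk ki] _]; rewrite /c' ltnNge Nk ki scale0r.
  have c'1 s k : cabs s <= 1 -> cabs (c' s k) <= 1.
    by rewrite /c'; case: ifP => // _; case: ifP => // _ _; rewrite cabs0.
  have par := hs_parallelogram H _ _ Px Py.
  have [big|] := lerP (q x ^+ 2 + q y ^+ 2) (q (x + y) ^+ 2).
    exists j, (c' 1); split=> [k|]; first by apply: c'1; rewrite cabs1.
    by rewrite sumE scale1r -natr1 mulrDl mul1r (le_trans _ big) ?lerD.
  move=> small; exists j, (c' (-1)); split=> [k|].
    by apply: c'1; rewrite cabsN cabs1.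
  rewrite sumE scaleN1r -natr1 mulrDl mul1r.
  by move: par small Mc ey; set h := e ^+ 2; lra.
have [M Mlarge] : exists M : nat, B ^+ 2 < M%:R * e ^+ 2.
  exists (Num.bound (B ^+ 2 / e ^+ 2)).
  rewrite -ltr_pdivrMr ?exprn_gt0 // archi_boundP //.
  by rewrite divr_ge0 ?sqr_ge0.
have [N [c [c1]]] := grow M; apply/negP; rewrite -ltNge.
apply: le_lt_trans Mlarge; have := uB N c c1.
by move=> qB; rewrite lerXn2r ?nnegrE ?(hs_ge0 H) // (le_trans (hs_ge0 H _) qB).
Qed.

(** If the finite subsums were unbounded, every index [a] would be followed by some
[b] with a subsum of norm more than 1 on indices in [a, b): the terms before [a]
contribute a bounded amount.  List the indices interval by interval, each time the
chosen ones first and then the others: this rearrangement of the series has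
blocks of norm more than 1 arbitrarily far out, hence is not Cauchy. *)
Lemma unconditional_bounded_subsums (u : nat -> V) :
  (forall k, P (u k)) ->
  (forall pi, bijective pi ->
     seminorm_cauchy q (fun N => \sum_(0 <= k < N) u (pi k))) ->
  exists B, forall N (S : pred nat), q (\sum_(0 <= k < N | S k) u k) <= B.
Proof.
move=> Pu uC; apply: contrapT => /forallNP nB.
have tail a : exists bS : nat * pred nat, (a < bS.1)%N /\
    1 < q (\sum_(a <= k < bS.1 | bS.2 k) u k).
  have /existsNP[N /existsNP[S /negP]] := nB (1 + \sum_(0 <= k < a) q (u k)).
  rewrite -ltNge => big; pose b := maxn N a.
  pose S' k := S k && (k < N)%N.
  have big' : 1 < q (\sum_(a <= k < b | S' k) u k).
    rewrite -(ltrD2r (\sum_(0 <= k < a) q (u k))) (lt_le_trans big) //.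
    have -> : \sum_(0 <= k < N | S k) u k = \sum_(0 <= k < b | S' k) u k.
      rewrite [RHS](big_cat_nat (n := N)) ?leq_maxl //= [X in _ = _ + X]big1_seq.
        rewrite addr0 big_nat_cond [RHS]big_nat_cond; apply: eq_bigl => k.
        by rewrite /S'; case: (S k) => //=; case: (k < N)%N.
      by move=> k /andP[/andP[_ kN]]; rewrite mem_index_iota leqNgt kN.
    rewrite (big_cat_nat (n := a)) ?leq_maxr //= addrC.
    rewrite (le_trans (hs_normD H _ _ _ _)) ?lerD2l //.
    - exact: hs_mem_sum (Pu 0%N) _.
    - exact: hs_mem_sum (Pu 0%N) _.
    - rewrite (le_trans (hs_norm_sum _ _ _ _ _ (Pu 0%N) _)) //.
      by rewrite big_mkcond ler_sum // => k _; case: ifP; rewrite // (hs_ge0 H).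
  exists (b, S'); split => //=; rewrite ltnNge; apply/negP => ba; move: big'.
  by rewrite big_geq // (hs_norm0 _ (Pu 0%N)) ltNge ler01.
have [nxt nxtP] := choice tail.
pose a j := iter j (fun a => (nxt a).1) 0%N.
pose I j := index_iota (a j) (a j.+1).
pose F j := seq.filter (nxt (a j)).2 (I j).
pose G j := seq.filter (predC (nxt (a j)).2) (I j).
(* L j enumerates the indices below a j in the new order. *)
pose L := fix L j := if j is j'.+1 then L j' ++ F j' ++ G j' else [::].
have aS j : (a j < a j.+1)%N by have [] := nxtP (a j).
have ja j : (j <= a j)%N by elim: j => // j /leq_ltn_trans; apply.
have permL j : perm_eq (L j) (iota 0 (a j)).
  elim: j => //= j IH; have -> : iota 0 (a j.+1) = iota 0 (a j) ++ I j.
    by rewrite /I /index_iota -iotaD subnKC // ltnW.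
  by rewrite perm_cat // perm_filterC.
have sizeL j : size (L j) = a j by rewrite (perm_size (permL j)) size_iota.
have prefL i j : (i <= j)%N -> exists s, L j = L i ++ s.
  elim: j => [|j IH]; first by rewrite leqn0 => /eqP ->; exists [::].
  rewrite leq_eqVlt => /predU1P[-> |/IH[s Lj]]; first by exists nil; rewrite cats0.
  exists (s ++ F j ++ G j); rewrite [LHS]/= -/(L j) Lj -catA. reflexivity.
have nthL i j k : (k < a i)%N -> (k < a j)%N -> nth 0 (L i) k = nth 0 (L j) k.
  wlog ij : i j / (i <= j)%N => [hw ki kj|ki _].
    by have [ij|/ltnW ij] := leqP i j; [exact: hw|rewrite (hw j i)].
  by have [s ->] := prefL _ _ ij; rewrite nth_cat sizeL ki.
pose pi k := nth 0 (L k.+1) k.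
have piE j k : (k < a j)%N -> pi k = nth 0 (L j) k by apply: nthL; exact: ja.
have memL v : v \in L v.+1 by rewrite (perm_mem (permL _)) mem_iota /= add0n ja.
pose inv v := index v (L v.+1).
have invK : cancel inv pi.
  move=> v; rewrite (piE v.+1) ?nth_index //.
  by rewrite -sizeL index_mem.
have pi_inj : injective pi.
  move=> k l; have kj : (k < a (maxn k l).+1)%N.
    by rewrite (leq_trans _ (ja _)) // ltnS leq_maxl.
  have lj : (l < a (maxn k l).+1)%N.
    by rewrite (leq_trans _ (ja _)) // ltnS leq_maxr.
  rewrite (piE _ _ kj) (piE _ _ lj) => /eqP.
  rewrite nth_uniq ?sizeL // ?(perm_uniq (permL _)) ?iota_uniq //.
  by move/eqP.
have pi_bij : bijective pi.
  by exists inv => // k; apply: pi_inj; rewrite invK.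
have [N NP] := uC pi pi_bij 1 ltr01.
have sumL M j : (M <= a j)%N ->
    \sum_(0 <= k < M) u (pi k) = \sum_(x <- take M (L j)) u x.
  move=> Mj; rewrite -(map_nth_iota0 0) ?sizeL // big_map /index_iota subn0.
  rewrite !big_seq; apply: eq_bigr => k; rewrite mem_iota /= add0n => kM.
  by rewrite (piE j) // (leq_trans kM).
have [_ big] := nxtP (a N).
have sizeF : (a N + size (F N) <= a N.+1)%N.
  by rewrite -(sizeL N.+1) /= !size_cat sizeL leq_add2l leq_addr.
have := NP (a N) (a N + size (F N))%N (ja N) (leq_addr _ _).
rewrite (sumL _ N.+1) // (sumL _ N.+1) ?(ltnW (aS N)) //=.
rewrite -!(sizeL N) takeD !take_size_cat // drop_size_cat // take_size_cat //.
rewrite big_cat /= addrAC subrr add0r big_filter leNgt => /negP; apply.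
exact: big.
Qed.

(** The principle of uniform boundedness, by nested balls.  If the norms of the
operators are unbounded, each ball contains a point where some operator exceeds n:
of x + w and x - w one works, since T w is half the difference of their images.
By continuity the operator still exceeds n on a smaller ball.  Halving the
radii gives a Cauchy sequence of centres, and at its limit the family exceeds
every n. *)
Lemma uniform_boundedness I (T : I -> V -> V) (Px : exists x, P x) :
  seminorm_complete P q ->
  (forall i c x y, T i (c *: x + y) = c *: T i x + T i y) ->
  (forall i x, P x -> P (T i x)) ->
  (forall i, exists B, forall x, P x -> q (T i x) <= B * q x) ->
  (forall x, P x -> exists B, forall i, q (T i x) <= B) ->
  exists2 B, 0 <= B & forall i x, P x -> q (T i x) <= B * q x.
Proof.
move=> cpl Tlin PT Tbnd Tptw; apply: contrapT => nB.
have TB i x y : T i (x - y) = T i x - T i y.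
  by rewrite addrC -scaleN1r Tlin scaleN1r addrC.
have T0 i : T i 0 = 0 by rewrite -[X in T i X](subrr 0) TB subrr.
have TZ i c x : T i (c *: x) = c *: T i x by rewrite -[c *: x]addr0 Tlin T0 addr0.
have TD i x y : T i (x + y) = T i x + T i y.
  by rewrite -[x]scale1r Tlin !scale1r.
have large B : 0 <= B -> exists i x, P x /\ B * q x < q (T i x).
  move=> B0; apply: contrapT => h; apply: nB; exists B => // i x px.
  by rewrite leNgt; apply/negP => hh; apply: h; exists i, x.
have escape x r (n : nat) : P x -> 0 < r ->
    exists i y, [/\ P y, q (y - x) <= r & n%:R < q (T i y)].
  move=> px r0; have [|i [z [pz qz]]] := large (n%:R / r).
    by rewrite divr_ge0 // ltW.
  have [b bP] := Tbnd i.
  have z0 : 0 < q z.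
    rewrite lt_neqAle (hs_ge0 H) andbT; apply/eqP => z0; move: qz.
    by rewrite -z0 mulr0 ltNge (le_trans (bP z pz)) // -z0 mulr0.
  pose c : R[i] := (r / q z)%:C%C; pose w := c *: z.
  have cE : cabs c = r / q z by rewrite cabs_real // divr_ge0 // ltW.
  have pw : P w by exact: (hs_memZ H).
  have qw : q w = r by rewrite (hs_normZ H) // cE divfK // gt_eqF.
  have qTw : n%:R < q (T i w).
    rewrite TZ (hs_normZ H) ?cE; last exact: PT.
    rewrite -(ltr_pM2r z0) mulrAC divfK ?gt_eqF //.
    rewrite -ltr_pdivrMl // mulrA [_^-1 * _]mulrC; exact: qz.
  have PTx := PT i _ px; have PTw := PT i _ pw.
  have Pp := hs_memD H _ _ PTx PTw; have Pm := hs_memB _ _ PTx PTw.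
  have max2 : 2 * q (T i w) <= q (T i x + T i w) + q (T i x - T i w).
    have -> : 2 * q (T i w) = q ((T i x + T i w) - (T i x - T i w)).
      have -> : (T i x + T i w) - (T i x - T i w) = (2%:R : R[i]) *: T i w.
        by rewrite opprD opprK addrACA subrr add0r scaler_nat mulr2n.
      rewrite (hs_normZ H) //; congr (_ * _).
      by rewrite -[LHS](@cabs_real R) // rmorph_nat.
    by rewrite -(hs_normN _ Pm) (hs_normD H) //; exact: hs_memN.
  have [big|small] := ltP n%:R (q (T i x + T i w)).
    exists i, (x + w); split; first exact: (hs_memD H).
      by rewrite addrC addKr qw.
    by rewrite TD.
  exists i, (x - w); split; first exact: hs_memB.
    by rewrite addrC addKr hs_normN // qw.
  by rewrite TB; move: max2 small qTw; lra.
(* A ball is coded as its centre and half its radius; the factor 2 leaves room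
   for the sum of all later steps. *)
have step (a : nat * (V * R)) : exists b : V * R,
    P a.2.1 -> 0 < a.2.2 -> [/\ P b.1, 0 < b.2, b.2 <= a.2.2 / 2,
      q (b.1 - a.2.1) <= a.2.2 & exists i, forall z, P z ->
      q (z - b.1) <= 2 * b.2 -> a.1%:R < q (T i z)].
  case: a => n [x r] /=; have [px|] := pselect (P x); last by exists (0, 0).
  have [r0|] := ltP 0 r; last by exists (0, 0).
  have [i [y [py yx ny]]] := escape x r n px r0.
  have [b bP] := Tbnd i; pose m := `|b| + 1.
  have m0 : 0 < m by rewrite ltr_wpDl.
  (* On the ball of radius 2 g, T i varies by at most half its excess over n. *)
  pose g := (q (T i y) - n%:R) / (4 * m).
  have g0 : 0 < g by rewrite divr_gt0 ?subr_gt0 ?mulr_gt0.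
  exists (y, Num.min (r / 2) g) => _ _ /=; split => //.
  - by rewrite lt_min g0 divr_gt0.
  - by rewrite ge_min lexx.
  exists i => z pz zy.
  have zy2 : q (z - y) <= 2 * g.
    by rewrite (le_trans zy) // ler_pM2l // ge_min lexx orbT.
  have pzy := hs_memB _ _ pz py.
  have Tzy : q (T i (z - y)) <= (q (T i y) - n%:R) / 2.
    have -> : (q (T i y) - n%:R) / 2 = m * (2 * g).
      by rewrite /g; field; rewrite gt_eqF.
    rewrite (le_trans (bP _ pzy)) //.
    rewrite (@le_trans _ _ (m * q (z - y))) ?ler_pM2l //.
    by rewrite ler_wpM2r ?(hs_ge0 H) // (le_trans (ler_norm b)) // lerDl.
  have : q (T i y) <= q (T i z) + q (T i (z - y)).
    have -> : T i y = T i z - T i (z - y) by rewrite TB opprB addrC subrK.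
    have [p1 p2] := (PT i _ pz, PT i _ pzy).
    by rewrite (le_trans (hs_normD H _ _ _ _)) ?(hs_normN _ p2) //; exact: hs_memN.
  by move: Tzy ny; lra.
have [f fP] := choice step; have [x0 px0] := Px.
pose st := fix st n := if n is n'.+1 then f (n', st n') else (x0, 1 : R).
have st_ok n : P (st n).1 /\ 0 < (st n).2.
  by elim: n => [|n [pn rn]] //=; have [] := fP (n, st n) pn rn.
have stP n := fP (n, st n) (st_ok n).1 (st_ok n).2.
pose x n := (st n.+1).1; pose r n := (st n.+1).2.
have px n : P (x n) := (st_ok n.+1).1.
have r0 n : 0 < r n := (st_ok n.+1).2.
have rS n : r n.+1 <= r n / 2 by have [] := stP n.+1.
have xS n : q (x n.+1 - x n) <= r n by have [] := stP n.+1.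
have rle k n : r (k + n)%N <= r k / 2 ^+ n.
  elim: n => [|n IH]; first by rewrite addn0 expr0 divr1.
  rewrite addnS exprSr invfM mulrA (le_trans (rS _)) //.
  by rewrite ler_pM2r ?invr_gt0 ?ltr0n.
have dist k n : q (x (k + n)%N - x k) <= 2 * r k - 2 * r (k + n)%N.
  elim: n => [|n IH].
    by rewrite addn0 !subrr (hs_norm0 _ px0).
  rewrite addnS -(subrK (x (k + n)%N) (x _)) -addrA.
  rewrite (le_trans (hs_normD H _ _ _ _)) //; do ?exact: hs_memB.
  by move: (xS (k + n)%N) (rS (k + n)%N) IH; lra.
have cau : seminorm_cauchy q x.
  move=> e e0; pose N := Num.bound (2 * r 0%N / e); exists N => i j Ni ij.
  rewrite -(subnKC ij) (le_trans (dist _ _)) //.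
  have ri : 2 * r i <= e.
    have := rle 0%N i; rewrite add0n => h.
    have r2 : r i * 2 ^+ i <= r 0%N by rewrite -ler_pdivlMr ?exprn_gt0.
    have Nb : 2 * r 0%N / e < N%:R.
      by rewrite archi_boundP // divr_ge0 ?mulr_ge0 // ltW.
    have : N%:R <= 2 ^+ i :> R.
      by rewrite -natrX ler_nat (leq_trans Ni) // ltnW // ltn_expl.
    rewrite ltr_pdivrMr // in Nb.
    move=> N2; rewrite -(ler_pM2r (exprn_gt0 i (ltr0Sn R 1))) -mulrA.
    rewrite (@le_trans _ _ (2 * r 0%N)) ?ler_pM2l // (le_trans (ltW Nb)) //.
    by rewrite mulrC ler_pM2l.
  by move: (r0 (i + (j - i))%N) ri; lra.
have [g pg gP] := cpl x px cau.
have near n : q (g - x n) <= 2 * r n.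
  apply/ler_addgt0Pr => e e0; have [N /(_ (n + N)%N (leq_addl _ _)) h] := gP e e0.
  rewrite -(subrK (x (n + N)%N) g) -addrA (le_trans (hs_normD H _ _ _ _)) //.
  - exact: hs_memB.
  - exact: hs_memB.
  rewrite -hs_normN ?opprB; last exact: hs_memB.
  by move: (dist n N) (r0 (n + N)%N) h; lra.
have [b bP] := Tptw g pg.
have [_ _ _ _ [i /(_ g pg (near _))]] := stP (Num.bound `|b|).
apply/negP; rewrite -leNgt (le_trans (bP i)) // (le_trans (ler_norm _)) //.
by rewrite ltW // archi_boundP.
Qed.

End HilbertSeminorm.

(** * The seminorm of complex L^2 *)

Definition cmeasurable {d} {X : measurableType d} {R : realType}
    (f : X -> R[i]) : Prop :=
  measurable_fun setT (fun x => complex.Re (f x)) /\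
  measurable_fun setT (fun x => complex.Im (f x)).

Definition L2sq {d} {X : measurableType d} {R : realType}
    (m : {measure set X -> \bar R}) (f : X -> R[i]) : \bar R :=
  (\int[m]_x (cabs (f x) ^+ 2)%:E)%E.

Definition L2seminorm {d} {X : measurableType d} {R : realType}
    (m : {measure set X -> \bar R}) (f : X -> R[i]) : R :=
  Num.sqrt (fine (L2sq m f)).

Lemma sqr_cabs {R : realType} (z : R[i]) :
  cabs z ^+ 2 = complex.Re z ^+ 2 + complex.Im z ^+ 2.
Proof. by case: z => a b /=; rewrite sqr_sqrtr // addr_ge0 ?sqr_ge0. Qed.

Lemma cabs_parallelogram {R : realType} (y z : R[i]) :
  cabs (y + z) ^+ 2 + cabs (y - z) ^+ 2 = 2 * cabs y ^+ 2 + 2 * cabs z ^+ 2.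
Proof. by rewrite !sqr_cabs; case: y z => [a b] [c e] /=; ring. Qed.

Section L2space.
Context {d} {X : measurableType d} {R : realType}.
Variable m : {measure set X -> \bar R}.
Implicit Types f g : X -> R[i].

Lemma cmeasurableD f g : cmeasurable f -> cmeasurable g -> cmeasurable (f + g).
Proof.
move=> [rf imf] [rg img]; split.
  rewrite (_ : (fun x => _) = (fun x => complex.Re (f x) + complex.Re (g x))).
    exact: measurable_funD.
  by apply/funext => x /=; rewrite fctE; case: (f x) (g x) => [a b] [].
rewrite (_ : (fun x => _) = (fun x => complex.Im (f x) + complex.Im (g x))).
  exact: measurable_funD.
by apply/funext => x /=; rewrite fctE; case: (f x) (g x) => [a b] [].
Qed.

Lemma cmeasurableZ c f : cmeasurable f -> cmeasurable (c *: f).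
Proof.
move=> [rf imf]; split.
  rewrite (_ : (fun x => _) = (fun x => complex.Re c * complex.Re (f x)
      - complex.Im c * complex.Im (f x))).
    by apply: measurable_funB; exact: measurable_funM.
  apply/funext => x /=; rewrite (_ : (c *: f) x = c * f x) //.
  by case: c (f x) => [a b] [].
rewrite (_ : (fun x => _) = (fun x => complex.Re c * complex.Im (f x)
    + complex.Im c * complex.Re (f x))).
  by apply: measurable_funD; exact: measurable_funM.
apply/funext => x /=; rewrite (_ : (c *: f) x = c * f x) //.
by case: c (f x) => [a b] [].
Qed.

Lemma measurable_sqr_cabs f : cmeasurable f ->
  measurable_fun setT (fun x => cabs (f x) ^+ 2).
Proof.
move=> [rf imf]; under eq_fun do rewrite sqr_cabs.
by apply: measurable_funD; exact: measurable_funX.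
Qed.

Lemma emeasurable_sqr_cabs f : cmeasurable f ->
  measurable_fun setT (fun x => (cabs (f x) ^+ 2)%:E : \bar R).
Proof. by move=> mf; apply/measurable_EFinP/measurable_sqr_cabs. Qed.

Lemma measurable_cabs f : cmeasurable f ->
  measurable_fun setT (fun x => cabs (f x)).
Proof.
move=> mf; rewrite (_ : (fun x => _) = (fun x => (cabs (f x) ^+ 2) `^ 2^-1)).
  by apply: (measurableT_comp (measurable_powR _)); exact: measurable_sqr_cabs.
by apply/funext => x; rewrite powR12_sqrt ?sqr_ge0 // sqrtr_sqr ger0_norm ?cabs_ge0.
Qed.

Lemma L2sq_ge0 f : (0 <= L2sq m f)%E.
Proof. by apply: integral_ge0 => x _; rewrite lee_fin sqr_ge0. Qed.

Lemma L2sq_le f g : cmeasurable f -> cmeasurable g ->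
  (forall x, cabs (f x) <= cabs (g x)) -> (L2sq m f <= L2sq m g)%E.
Proof.
move=> mf mg fg; apply: ge0_le_integral => //.
- by move=> x _; rewrite lee_fin sqr_ge0.
- exact: emeasurable_sqr_cabs.
- exact: emeasurable_sqr_cabs.
- by move=> x _; rewrite lee_fin lerXn2r ?nnegrE ?cabs_ge0.
Qed.

Lemma L2norm_poweR f : L2norm m f = (L2sq m f `^ 2^-1)%E.
Proof.
rewrite /L2norm unlock /L2sq; congr (_ `^ _)%E; apply: eq_integral => x _.
by rewrite /= ger0_norm ?cabs_ge0 // powR_mulrn ?cabs_ge0.
Qed.

Lemma L2normE f : (L2sq m f < +oo)%E -> L2norm m f = (L2seminorm m f)%:E.
Proof.
move=> fy; rewrite L2norm_poweR /L2seminorm -powR12_sqrt ?fine_ge0 ?L2sq_ge0 //.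
by rewrite -poweR_EFin fineK // ge0_fin_numE // L2sq_ge0.
Qed.

Lemma L2sq_fin f : (L2norm m f < +oo)%E = (L2sq m f < +oo)%E.
Proof.
apply/idP/idP => [|fy]; last by rewrite L2normE // ltry.
rewrite L2norm_poweR; move: (L2sq_ge0 f); case: (L2sq m f) => // [r _ _|_].
  exact: ltry.
by rewrite poweRyr // gt_eqF // invr_gt0.
Qed.

Lemma inL2P f : inL2 m f <-> cmeasurable f /\ (L2sq m f < +oo)%E.
Proof. by rewrite -L2sq_fin; split=> [[]|[[]]]. Qed.

Lemma L2seminorm_ge0 f : 0 <= L2seminorm m f.
Proof. exact: sqrtr_ge0. Qed.

Lemma L2sqE f : inL2 m f -> L2sq m f = (L2seminorm m f ^+ 2)%:E.
Proof.
move=> /inL2P[_ fy]; rewrite /L2seminorm sqr_sqrtr ?fine_ge0 ?L2sq_ge0 //.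
by rewrite fineK // ge0_fin_numE // L2sq_ge0.
Qed.

Lemma L2sq_parallelogram f g : cmeasurable f -> cmeasurable g ->
  (L2sq m (f + g)%R + L2sq m (f - g)%R = 2%:E * L2sq m f + 2%:E * L2sq m g)%E.
Proof.
move=> mf mg; have mN : cmeasurable (- g) by rewrite -scaleN1r; exact: cmeasurableZ.
have ge0 h x : [set: X] x -> (0 <= (cabs (h x) ^+ 2)%:E :> \bar R)%E.
  by rewrite lee_fin sqr_ge0.
rewrite -!ge0_integralZl_EFin //; do ?exact: emeasurable_sqr_cabs.
rewrite -!ge0_integralD //.
- by apply: eq_integral => x _; rewrite -!EFinM -!EFinD cabs_parallelogram.
- by move=> x _; rewrite lee_fin mulr_ge0 ?sqr_ge0.
- by apply: measurable_funeM; exact: emeasurable_sqr_cabs.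
- by move=> x _; rewrite lee_fin mulr_ge0 ?sqr_ge0.
- by apply: measurable_funeM; exact: emeasurable_sqr_cabs.
- exact: ge0.
- by apply: emeasurable_sqr_cabs; exact: cmeasurableD.
- exact: ge0.
- by apply: emeasurable_sqr_cabs; exact: cmeasurableD.
- exact: ge0.
- exact: ge0.
Qed.

Lemma L2sqZ c f : cmeasurable f ->
  L2sq m (c *: f) = ((cabs c ^+ 2)%:E * L2sq m f)%E.
Proof.
move=> mf; rewrite -ge0_integralZl_EFin ?sqr_ge0 //.
- apply: eq_integral => x _; rewrite (_ : (c *: f) x = c * f x) //.
  by rewrite cabsM exprMn EFinM.
- by move=> x _; rewrite lee_fin sqr_ge0.
- exact: emeasurable_sqr_cabs.
Qed.

Lemma inL2Z c f : inL2 m f -> inL2 m (c *: f).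
Proof.
move=> /inL2P[mf fy]; apply/inL2P; split; first exact: cmeasurableZ.
by rewrite L2sqZ // lte_mul_pinfty // lee_fin sqr_ge0.
Qed.

Lemma inL2D f g : inL2 m f -> inL2 m g -> inL2 m (f + g).
Proof.
move=> /inL2P[mf fy] /inL2P[mg gy]; apply/inL2P; split; first exact: cmeasurableD.
rewrite (le_lt_trans (leeDl _ (L2sq_ge0 (f - g)%R))) // L2sq_parallelogram //.
by rewrite lte_add_pinfty // lte_mul_pinfty // lee_fin.
Qed.

(** Minkowski for the real functions |f| and |g|, through the real-valued
function |f| + |g|, which dominates |f + g|. *)
Lemma L2norm_triangle f g : cmeasurable f -> cmeasurable g ->
  (L2norm m (f + g)%R <= L2norm m f + L2norm m g)%E.
Proof.
move=> mf mg; rewrite (le_trans _ (minkowski_EFin _ _ _ _)) ?ler1n //;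
  do ?exact: measurable_cabs.
pose h x : R[i] := (cabs (f x) + cabs (g x))%:C%C.
have hE x : cabs (h x) = cabs (f x) + cabs (g x).
  by rewrite cabs_real // addr_ge0 ?cabs_ge0.
rewrite (_ : Lnorm _ _ _ = L2norm m h); last first.
  by rewrite /L2norm; congr Lnorm; apply/funext => x; rewrite hE.
rewrite !L2norm_poweR; apply: gt0_ler_poweR;
  rewrite ?invr_ge0 ?in_itv /= ?leey ?L2sq_ge0 //.
apply: L2sq_le; first exact: cmeasurableD.
  split => //=; apply: measurable_funD; exact: measurable_cabs.
by move=> x; rewrite hE cabsD.
Qed.

Lemma L2_hilbert_seminorm : hilbert_seminorm (inL2 m) (L2seminorm m).
Proof.
split.
- exact: inL2D.
- exact: inL2Z.
- exact: L2seminorm_ge0.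
- move=> c f /inL2P[mf fy].
  rewrite /L2seminorm L2sqZ // fineM //; last by rewrite ge0_fin_numE ?L2sq_ge0.
  by rewrite sqrtrM ?sqr_ge0 //= sqrtr_sqr ger0_norm ?cabs_ge0.
- move=> f g Lf Lg; have [_ fgy] := (inL2P _).1 (inL2D _ _ Lf Lg).
  move: Lf Lg => /inL2P[mf fy] /inL2P[mg gy].
  by rewrite -lee_fin EFinD -!L2normE // L2norm_triangle.
- move=> f g Lf Lg; have Lm : inL2 m (f - g).
    by rewrite -scaleN1r; apply: inL2D => //; exact: inL2Z.
  have /inL2P[mf _] := Lf; have /inL2P[mg _] := Lg.
  have := L2sq_parallelogram _ _ mf mg; rewrite !L2sqE //; last exact: inL2D.
  by rewrite -!EFinM -!EFinD => -[].
Qed.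

End L2space.

Lemma cabs_ge_Re {R : realType} (z : R[i]) : `|complex.Re z| <= cabs z.
Proof. by rewrite -lecR cabsE normc_ge_Re. Qed.

Lemma cabs_ge_Im {R : realType} (z : R[i]) : `|complex.Im z| <= cabs z.
Proof.
rewrite -(ger0_norm (cabs_ge0 z)) -ler_sqr ?nnegrE // real_normK ?num_real //.
by rewrite [leRHS]real_normK ?num_real // sqr_cabs lerDr sqr_ge0.
Qed.

(** * Completeness of L^2 *)

Section L2complete.
Context {d} {X : measurableType d} {R : realType}.
Variable m : {measure set X -> \bar R}.
Local Notation q := (L2seminorm m).
Local Notation H := (L2_hilbert_seminorm m).

Lemma limn_einf_le (u : nat -> \bar R) (a : \bar R) :
  (forall n, (u n <= a)%E) -> (limn_einf u <= a)%E.
Proof.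
move=> ua; rewrite limn_einf_lim; apply: lime_le; first exact: is_cvg_einfs.
near=> n; rewrite (le_trans _ (ua n)) //; apply: ereal_inf_lbound.
by exists n => //=.
Unshelve. all: by end_near. Qed.

(** Fatou, applied on a set of full measure where s_k converges pointwise to g. *)
Lemma ae_sub_L2seminorm_le (s : nat -> X -> R[i]) (f g : X -> R[i]) (E : set X)
    (e : R) :
  measurable E -> m (~` E) = 0%E -> (forall k, inL2 m (s k)) -> inL2 m f ->
  cmeasurable g ->
  (forall x, E x -> complex.Re (s k x) @[k --> \oo] --> complex.Re (g x)) ->
  (forall x, E x -> complex.Im (s k x) @[k --> \oo] --> complex.Im (g x)) ->
  (forall k, q (f - s k) <= e) ->
  (L2sq m (f - g)%R <= (e ^+ 2)%:E)%E.
Proof.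
move=> mE E0 Ls Lf mg cre cim se.
have Lfs k : inL2 m (f - s k) by exact: (hs_memB H).
have mfs k : cmeasurable (f - s k) by have /inL2P[] := Lfs k.
have mfg : cmeasurable (f - g).
  apply: cmeasurableD; first by have /inL2P[] := Lf.
  by rewrite -scaleN1r; exact: cmeasurableZ.
have e0 : 0 <= e by rewrite (le_trans _ (se 0%N)) ?L2seminorm_ge0.
rewrite /L2sq (ge0_negligible_integral _ _ _ _ E0) //; last 3 first.
- exact: measurableC.
- exact: emeasurable_sqr_cabs.
- by move=> x _; rewrite lee_fin sqr_ge0.
rewrite setTD setCK.
pose F k x : \bar R := (cabs ((f - s k) x) ^+ 2)%:E.
rewrite (eq_integral (fun x => limn_einf (F^~ x))); last first.
  move=> x /[!inE] Ex; apply/esym/(cvg_limn_einf_sup _).1; apply: cvg_EFin.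
    by near=> k.
  rewrite /comp /F /=; under eq_fun do rewrite sqr_cabs.
  rewrite sqr_cabs.
  have re k : complex.Re ((f - s k) x) = complex.Re (f x) - complex.Re (s k x).
    by rewrite /= !fctE; case: (f x) (s k x) => [a b] [].
  have im k : complex.Im ((f - s k) x) = complex.Im (f x) - complex.Im (s k x).
    by rewrite /= !fctE; case: (f x) (s k x) => [a b] [].
  have rg : complex.Re ((f - g) x) = complex.Re (f x) - complex.Re (g x).
    by rewrite /= !fctE; case: (f x) (g x) => [a b] [].
  have ig : complex.Im ((f - g) x) = complex.Im (f x) - complex.Im (g x).
    by rewrite /= !fctE; case: (f x) (g x) => [a b] [].
  rewrite rg ig; under eq_fun do rewrite re im.
  have c1 : complex.Re (f x) - complex.Re (s k x) @[k --> \oo]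
      --> complex.Re (f x) - complex.Re (g x).
    by apply: cvgB; [exact: cvg_cst|exact: cre].
  have c2 : complex.Im (f x) - complex.Im (s k x) @[k --> \oo]
      --> complex.Im (f x) - complex.Im (g x).
    by apply: cvgB; [exact: cvg_cst|exact: cim].
  by rewrite !expr2; apply: cvgD; exact: cvgM.
apply: le_trans (fatou _ _ _ _) _ => //.
- by move=> k; apply: measurable_funTS; exact: emeasurable_sqr_cabs.
- by move=> k x _; rewrite lee_fin sqr_ge0.
apply: limn_einf_le => k.
rewrite (le_trans (ge0_subset_integral _ mE measurableT _ _ _)) //.
- exact: emeasurable_sqr_cabs.
- by move=> x _; rewrite lee_fin sqr_ge0.
rewrite -/(L2sq m (f - s k)) L2sqE // lee_fin lerXn2r ?nnegrE //.
exact: L2seminorm_ge0.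
Unshelve. all: by end_near. Qed.

(** The function G = sum of 2^k |s_(k+1) - s_k|^2 has a finite integral, hence is
finite almost everywhere, and where it is finite the increments are absolutely
summable because t <= 2^(-k) + 2^k t^2. *)
Lemma ae_limit_of_fast_L2_cauchy (s : nat -> X -> R[i]) :
  (forall k, inL2 m (s k)) -> (forall k, q (s k.+1 - s k) <= 2^-1 ^+ k.+1) ->
  exists g (E : set X), [/\ measurable E, m (~` E) = 0%E, cmeasurable g,
    forall x, E x -> complex.Re (s k x) @[k --> \oo] --> complex.Re (g x) &
    forall x, E x -> complex.Im (s k x) @[k --> \oo] --> complex.Im (g x)].
Proof.
move=> Ls fast; pose D k := s k.+1 - s k.
have LD k : inL2 m (D k) by exact: (hs_memB H).
have mD k : cmeasurable (D k) by have /inL2P[] := LD k.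
have ms k : cmeasurable (s k) by have /inL2P[] := Ls k.
pose h k x : \bar R := ((2 ^+ k)%:E * (cabs (D k x) ^+ 2)%:E)%E.
have h0 k x : (0 <= h k x)%E by rewrite mule_ge0 // lee_fin ?sqr_ge0 ?exprn_ge0.
have mh k : measurable_fun setT (h k).
  by apply: measurable_funeM; exact: emeasurable_sqr_cabs.
pose G x := (\sum_(0 <= k <oo) h k x)%E.
have G0 x : (0 <= G x)%E by apply: nneseries_ge0 => k _ _.
have mG : measurable_fun setT G by apply: ge0_emeasurable_sum.
have iG : (\int[m]_x G x < +oo)%E.
  rewrite integral_nneseries //.
  apply: (@le_lt_trans _ _ 1%E); last by rewrite ltry.
  apply: le_trans (epsilon_trick0 xpredT ler01).
  apply: lee_nneseries => [k _ _|k _]; first by apply: integral_ge0 => x _.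
  rewrite /h ge0_integralZl_EFin ?exprn_ge0 //; last 2 first.
  - by move=> x _; rewrite lee_fin sqr_ge0.
  - exact: emeasurable_sqr_cabs.
  rewrite -/(L2sq m (D k)) L2sqE // -EFinM lee_fin div1r natrX.
  have fk : q (D k) ^+ 2 <= (2^-1 ^+ k.+1) ^+ 2.
    by rewrite lerXn2r ?nnegrE ?L2seminorm_ge0 //; exact: fast.
  rewrite (le_trans (ler_wpM2l _ fk)) ?exprn_ge0 //.
  rewrite -exprVn [2^-1 ^+ k.+1]exprS; set w := 2^-1 ^+ k; set a := 2 ^+ k.
  have aw : a * w = 1 by rewrite /a /w exprVn divff // expf_neq0 // pnatr_eq0.
  have w0 : 0 <= w by rewrite exprn_ge0 // invr_ge0.
  have -> : a * (2^-1 * w) ^+ 2 = (a * w) * (w / 4) by field.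
  by rewrite aw; lra.
pose E := [set x | (G x < +oo)%E].
have mE : measurable E.
  by rewrite -[E]setTI; exact: (emeasurable_fun_infty_o measurableT mG).
have E0 : m (~` E) = 0%E.
  apply: measure_negligible; first exact: measurableC.
  have /(integrable_ae measurableT) : m.-integrable setT G.
    apply/integrableP; split => //.
    by under eq_integral do rewrite gee0_abs //.
  apply: negligibleS => x /= nE Gx; apply: nE.
  by rewrite /E /= -ge0_fin_numE // Gx.
have summable (a : nat -> R) x : E x -> (forall k, `|a k| <= cabs (D k x)) ->
    cvgn (series a).
  move=> Ex aD; apply: normed_cvg; apply: nondecreasing_is_cvgn.
    by apply: nondecreasing_series => k _ _; exact: normr_ge0.
  exists (2 + fine (G x)) => _ [n _ <-]; rewrite /series /=.
  have termwise k : `|a k| <= 2^-1 ^+ k + 2 ^+ k * cabs (D k x) ^+ 2.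
    rewrite (le_trans (aD k)) //; set t := cabs _; set w : R := 2 ^+ k.
    have w0 : 0 < w by rewrite exprn_gt0.
    rewrite exprVn -/w -(ler_pM2l w0) mulrDr divff ?gt_eqF //.
    have -> : w * (w * t ^+ 2) = (w * t) ^+ 2 by ring.
    have := sqr_ge0 (w * t - 1); have := sqr_ge0 (w * t).
    by rewrite sqrrB1; set v := (w * t) ^+ 2; lra.
  have geo j : \sum_(0 <= k < j) 2^-1 ^+ k <= 2 - 2 * 2^-1 ^+ j :> R.
    elim: j => [|j IH]; first by rewrite big_nil expr0; lra.
    by rewrite big_nat_recr //= exprS; move: IH; lra.
  rewrite (le_trans (ler_sum _ (fun k _ => termwise k))) // big_split /= lerD //.
    by rewrite (le_trans (geo n)) // gerBl mulr_ge0 // exprn_ge0 // invr_ge0.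
  rewrite -lee_fin fineK ?ge0_fin_numE // -sumEFin.
  by apply: (@nneseries_lim_ge _ (h^~ x)) => k _ _.
have cvg_part (P : R[i] -> R) : (forall y z, P (y - z) = P y - P z) ->
    (forall z, `|P z| <= cabs z) ->
    forall x, E x -> cvgn (fun k => P (s k x)).
  move=> PB Pc x Ex.
  have := summable (fun k => P (D k x)) x Ex (fun k => Pc _).
  rewrite (_ : series _ = fun k => P (s k x) - P (s 0%N x)) => [c|].
    rewrite (_ : (fun k => _) = fun k => P (s k x) - P (s 0%N x) + P (s 0%N x)).
      by apply: is_cvgD => //; exact: is_cvg_cst.
    by apply/funext => k; rewrite subrK.
  apply/funext => n; rewrite /series /= -(telescope_sumr (fun k => P (s k x))) //.
  by apply: eq_bigr => k _; rewrite -PB.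
have cre := cvg_part (@complex.Re R)
  (fun y z => ltac:(by case: y z => [a b] [])) cabs_ge_Re.
have cim := cvg_part (@complex.Im R)
  (fun y z => ltac:(by case: y z => [a b] [])) cabs_ge_Im.
pose g x : R[i] := if x \in E then
  Complex (limn (fun k => complex.Re (s k x))) (limn (fun k => complex.Im (s k x)))
  else 0.
have gcvg (P : R[i] -> R) : P 0 = 0 ->
    (forall k, measurable_fun setT (fun x => P (s k x))) ->
    (forall x, E x -> P (s k x) @[k --> \oo] --> P (g x)) ->
    measurable_fun setT (fun x => P (g x)).
  move=> P0 mP cP.
  apply: (@measurable_fun_cvg _ _ _ _ (fun k x => P (s k x) * \1_E x)).
    by move=> k; apply: measurable_funM => //; exact: measurable_indic.
  move=> x _; have [xE|xE] := boolP (x \in E).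
    under eq_fun do rewrite indicE xE mulr1.
    by apply: cP; rewrite inE in xE.
  under eq_fun do rewrite indicE (negbTE xE) mulr0.
  by rewrite /g (negbTE xE) P0; exact: cvg_cst.
have gre x : E x -> complex.Re (s k x) @[k --> \oo] --> complex.Re (g x).
  by move=> Ex; rewrite /g ifT ?inE //=; exact: cre.
have gim x : E x -> complex.Im (s k x) @[k --> \oo] --> complex.Im (g x).
  by move=> Ex; rewrite /g ifT ?inE //=; exact: cim.
exists g, E; split => //; split; apply: gcvg => // k; by have [] := ms k.
Qed.

(** A Cauchy sequence has a fast subsequence, which converges almost everywhere;
Fatou turns the Cauchy estimate into an estimate of the distance to the limit. *)
Lemma L2_complete : seminorm_complete (inL2 m) q.
Proof.
move=> s Ls sC.
have half_gt0 k : 0 < 2^-1 ^+ k.+1 :> R by rewrite exprn_gt0 ?invr_gt0.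
have [N NP] := choice (fun k : nat => sC (2^-1 ^+ k.+1) (half_gt0 k)).
pose phi k := (\sum_(i < k.+1) (N i).+1)%N.
have phiS k : (phi k <= phi k.+1)%N by rewrite /phi [leqRHS]big_ord_recr leq_addr.
have Nphi k : (N k <= phi k)%N.
  by rewrite /phi big_ord_recr /= (leq_trans _ (leq_addl _ _)).
have phi_ge k : (k <= phi k)%N.
  elim: k => // k IH; rewrite /phi big_ord_recr /= addnS ltnS.
  by rewrite (leq_trans IH) // leq_addr.
have [|k|g [E [mE E0 mg gre gim]]] :=
  @ae_limit_of_fast_L2_cauchy (fun k => s (phi k)); first by [].
  exact: (NP k _ _ (Nphi k) (phiS k)).
have near_g e : 0 < e -> exists M, forall i, (M <= i)%N ->
    (L2sq m (s i - g)%R <= (e ^+ 2)%:E)%E.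
  move=> e0; have [M MP] := sC e e0; exists M => i Mi.
  apply: (@ae_sub_L2seminorm_le (fun k => s (phi (k + i)%N)) _ _ E) => //.
  - move=> x Ex; rewrite (cvg_shiftn i (fun k => complex.Re (s (phi k) x))).
    exact: gre.
  - move=> x Ex; rewrite (cvg_shiftn i (fun k => complex.Im (s (phi k) x))).
    exact: gim.
  move=> k; rewrite -opprB (hs_normN H); last exact: (hs_memB H).
  by apply: MP => //; rewrite (leq_trans _ (phi_ge _)) // leq_addl.
have Lsg i e : (L2sq m (s i - g)%R <= (e ^+ 2)%:E)%E -> inL2 m (s i - g).
  move=> le; apply/inL2P; split; last by rewrite (le_lt_trans le) // ltry.
  apply: cmeasurableD; first by have /inL2P[] := Ls i.
  by rewrite -scaleN1r; exact: cmeasurableZ.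
exists g.
  have [M /(_ M (leqnn M)) /Lsg LM] := near_g 1 ltr01.
  by have -> : g = s M - (s M - g); [rewrite opprB addrC subrK|exact: (hs_memB H)].
move=> e e0; have [M MP] := near_g e e0; exists M => i Mi.
have := MP i Mi; rewrite L2sqE; last exact: Lsg (MP i Mi).
by rewrite lee_fin ler_pXn2r ?nnegrE ?L2seminorm_ge0 // ltW.
Qed.

End L2complete.

Lemma toeplitz_bound_cabs {R : realType} (p : {poly R[i]}) (B : R)
    (a : nat -> R[i]) N K :
  (size p <= K)%N -> (forall z, cabs z = 1 -> cabs p.[z] <= B) ->
  \sum_(j < N) cabs (seqval (fun k => a (j + k)%N) p) ^+ 2
    <= B ^+ 2 * \sum_(j < N + K) cabs (a j) ^+ 2.
Proof.
move=> pK pB; rewrite -lecR rmorphM rmorphXn !rmorph_sum /=.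
rewrite (eq_bigr (fun j : 'I_N => `|seqval (fun k => a (j + k)%N) p| ^+ 2)).
  rewrite [in leRHS](eq_bigr (fun j : 'I_(N + K) => `|a j| ^+ 2)).
    apply: toeplitz_bound => // z z1; rewrite -cabsE lecR pB //.
    by apply: complexI; rewrite cabsE z1.
  by move=> j _; rewrite rmorphXn /= cabsE.
by move=> j _; rewrite rmorphXn /= cabsE.
Qed.

Lemma le_of_mulr_natD {R : realType} (a b c : R) :
  (forall N : nat, N%:R * a <= N%:R * b + c) -> a <= b.
Proof.
move=> h; rewrite leNgt; apply/negP => ab; have ab0 : 0 < a - b by rewrite subr_gt0.
have := h (Num.bound (`|c| / (a - b))); apply/negP; rewrite -ltNge.
rewrite -ltrBrDl -mulrBr (le_lt_trans (ler_norm c)) // -ltr_pdivrMr //.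
by rewrite archi_boundP // divr_ge0 // ltW.
Qed.

(** * Polynomials of a measure-preserving map *)

(** This is p(U) f for the composition operator U f = f \o tau. *)
Definition polyact {X : Type} {R : realType} (tau : X -> X) (p : {poly R[i]})
    (f : X -> R[i]) : X -> R[i] :=
  fun x => seqval (fun k => f (iter k tau x)) p.

Section MeasurePreserving.
Context {d} {X : measurableType d} {R : realType}.
Variables (m : probability X R) (tau : X -> X).
Hypothesis tau_mp : measure_preserving m tau.

Lemma measurable_iter k : measurable_fun setT (iter k tau).
Proof.
elim: k => [|k IH]; first exact: measurable_id.
by apply: measurableT_comp => //; exact: tau_mp.1.
Qed.

Lemma measure_preimage_iter k A : measurable A -> m (iter k tau @^-1` A) = m A.
Proof.
move=> mA; elim: k => [|k IH] //.
have -> : iter k.+1 tau = iter k tau \o tau by apply/funext => x; exact: iterSr.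
rewrite comp_preimage tau_mp.2 //.
by rewrite -[_ @^-1` _]setTI; exact: (measurable_iter k measurableT).
Qed.

Lemma ge0_integral_iter k (h : X -> \bar R) : measurable_fun setT h ->
  (forall x, (0 <= h x)%E) ->
  (\int[m]_x h (iter k tau x) = \int[m]_x h x)%E.
Proof.
move=> mh h0; have mk := measurable_iter k.
rewrite -[LHS](@ge0_integral_pushforward _ _ _ _ _ _ mk m setT h) //.
by apply: eq_measure_integral => A mA _; exact: measure_preimage_iter.
Qed.

Lemma cmeasurable_iter k (f : X -> R[i]) :
  cmeasurable f -> cmeasurable (f \o iter k tau).
Proof.
by move=> [re im]; split;
  [apply: (measurableT_comp re) | apply: (measurableT_comp im)];
  exact: measurable_iter.
Qed.

Lemma L2sq_iter k (f : X -> R[i]) : cmeasurable f ->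
  L2sq m (f \o iter k tau) = L2sq m f.
Proof.
move=> mf; apply: (ge0_integral_iter k (fun x => (cabs (f x) ^+ 2)%:E)).
  exact: emeasurable_sqr_cabs.
by move=> x; rewrite lee_fin sqr_ge0.
Qed.

Lemma inL2_iter k (f : X -> R[i]) : inL2 m f -> inL2 m (f \o iter k tau).
Proof.
move=> /inL2P[mf fy]; apply/inL2P; split; first exact: cmeasurable_iter.
by rewrite L2sq_iter.
Qed.

Lemma polyactE (p : {poly R[i]}) (f : X -> R[i]) :
  polyact tau p f = \sum_(i < size p) p`_i *: (f \o iter i tau).
Proof. by apply/funext => x; rewrite fct_sumE. Qed.

Lemma inL2_polyact p (f : X -> R[i]) : inL2 m f -> inL2 m (polyact tau p f).
Proof.
move=> Lf; rewrite polyactE; apply: (hs_mem_sum (L2_hilbert_seminorm m) f) => //.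
by move=> i; apply: inL2Z; exact: inL2_iter.
Qed.

Lemma polyact_linear p c (f g : X -> R[i]) :
  polyact tau p (c *: f + g) = c *: polyact tau p f + polyact tau p g.
Proof.
rewrite !polyactE scaler_sumr -big_split /=; apply: eq_bigr => i _.
rewrite (_ : (c *: f + g) \o _ = c *: (f \o iter i tau) + (g \o iter i tau)) //.
by rewrite scalerDr !scalerA mulrC.
Qed.

Lemma polyact_iter p (f : X -> R[i]) j x :
  polyact tau p f (iter j tau x) = seqval (fun k => f (iter (j + k) tau x)) p.
Proof. by apply: eq_bigr => i _; rewrite -iterD addnC. Qed.

(** The norm can be averaged over an orbit: since tau preserves m,
N |p(U) f|^2 is the integral of the sum of |p(U) f|^2 over the first N points of
the orbit of x.  For each x the Toeplitz bound compares that sum with B^2 times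
the sum of |f|^2 over N + K points, where K is the number of coefficients of p.
Hence N |p(U) f|^2 <= B^2 (N + K) |f|^2 for all N. *)
Lemma von_neumann_inequality (p : {poly R[i]}) (B : R) (f : X -> R[i]) :
  (forall z, cabs z = 1 -> cabs p.[z] <= B) -> inL2 m f ->
  L2seminorm m (polyact tau p f) <= B * L2seminorm m f.
Proof.
move=> pB Lf; have Lp := inL2_polyact p _ Lf.
have B0 : 0 <= B by apply: le_trans (pB 1 cabs1); exact: cabs_ge0.
rewrite -(@ler_pXn2r _ 2) ?nnegrE ?mulr_ge0 ?L2seminorm_ge0 // exprMn.
set a := L2seminorm m (polyact _ _ _) ^+ 2; set b := L2seminorm m f ^+ 2.
have ea : L2sq m (polyact tau p f) = a%:E by rewrite L2sqE.
have eb : L2sq m f = b%:E by rewrite L2sqE.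
clearbody a b.
have [mf _] := (inL2P _ _).1 Lf; have [mp _] := (inL2P _ _).1 Lp.
pose K := size p; apply: (@le_of_mulr_natD _ _ _ (K%:R * (B ^+ 2 * b))) => N.
have Esum (g : X -> R[i]) c M : cmeasurable g -> L2sq m g = c%:E ->
    (\int[m]_x (\sum_(j < M) cabs (g (iter j tau x)) ^+ 2)%:E = (M%:R * c)%:E)%E.
  move=> mg gc; under eq_integral do rewrite -sumEFin.
  rewrite ge0_integral_sum //; last 2 first.
  - by move=> j; apply: emeasurable_sqr_cabs; exact: (cmeasurable_iter j).
  - by move=> j x _; rewrite lee_fin sqr_ge0.
  rewrite (eq_bigr (fun=> c%:E)).
    by rewrite sumEFin sumr_const card_ord mulr_natl.
  by move=> j _; rewrite -gc; exact: (L2sq_iter j).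
rewrite -mulrDl -natrD [leRHS]mulrCA -lee_fin -(Esum _ _ _ mp ea) EFinM.
rewrite -(Esum _ _ _ mf eb) -ge0_integralZl_EFin ?sqr_ge0 //; last 2 first.
- by move=> x _; rewrite lee_fin sumr_ge0 // => j _; rewrite sqr_ge0.
- apply/measurable_EFinP; apply: measurable_sum => j.
  by apply: measurable_sqr_cabs; exact: (cmeasurable_iter j).
apply: ge0_le_integral => //.
- by move=> x _; rewrite lee_fin sumr_ge0 // => j _; rewrite sqr_ge0.
- apply/measurable_EFinP; apply: measurable_sum => j.
  by apply: measurable_sqr_cabs; exact: (cmeasurable_iter j).
- apply: measurable_funeM; apply/measurable_EFinP; apply: measurable_sum => j.
  by apply: measurable_sqr_cabs; exact: (cmeasurable_iter j).
move=> x _; rewrite -EFinM lee_fin.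
under eq_bigr => j _ do rewrite polyact_iter.
exact: (@toeplitz_bound_cabs _ p B (fun j => f (iter j tau x)) N K).
Qed.

End MeasurePreserving.

(** * Towers and values on the circle *)

(** Of a proper part of A and its complement in A, one has at most half the measure
of A. *)
Lemma nonatomic_small {d} {X : measurableType d} {R : realType}
    (m : probability X R) k : nonatomic m ->
  exists A, [/\ measurable A, (0 < m A)%E & (m A <= (2^-1 ^+ k)%:E)%E].
Proof.
move=> na; elim: k => [|k [A [mA A0 Ak]]].
  exists setT; rewrite probability_setT expr0; split => //.
have [B [mB BA B0 mBA]] := na A mA A0.
have fA : m A \is a fin_num := fin_num_measure _ _ mA.
have fB : m B \is a fin_num := fin_num_measure _ _ mB.
have mD : measurable (A `\` B) by exact: measurableD.
have fD : m (A `\` B) \is a fin_num := fin_num_measure _ _ mD.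
have AE : m A = (m (A `\` B) + m B)%E.
  by rewrite (measureDI m mA mB) (setIidr BA).
pose a := fine (m A); pose b := fine (m B); pose c := fine (m (A `\` B)).
have ac : a = c + b by apply: EFin_inj; rewrite EFinD !fineK.
have b0 : 0 < b by rewrite -lte_fin fineK.
have ba : b < a by rewrite -lte_fin !fineK.
have ak : a <= 2^-1 ^+ k by rewrite -lee_fin fineK.
have [small|large] := lerP b (a / 2).
  exists B; split=> //; rewrite -[leLHS](fineK fB) lee_fin exprS -/b.
  by lra.
exists (A `\` B); split=> //.
  by rewrite -[ltRHS](fineK fD) lte_fin -/c; lra.
by rewrite -[leLHS](fineK fD) lee_fin exprS -/c; lra.
Qed.

Section Tower.
Context {d} {X : measurableType d} {R : realType}.
Variables (m : probability X R) (tau : X -> X).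
Hypothesis tau_mp : measure_preserving m tau.

Lemma measurable_preimage_iter k A : measurable A ->
  measurable (iter k tau @^-1` A).
Proof.
move=> mA; rewrite -[_ @^-1` _]setTI.
exact: (measurable_iter _ _ tau_mp k measurableT).
Qed.

(** The set of points whose orbit visits A infinitely often is strictly invariant,
and has measure at least m A as a decreasing limit of sets that contain a preimage
of A.  By ergodicity it has full measure. *)
Lemma ergodic_sweep (A : set X) : ergodic m tau ->
  measurable A -> (0 < m A)%E -> m (\bigcup_k (iter k tau @^-1` A)) = 1%E.
Proof.
move=> erg mA A0.
pose F k := \bigcup_(j in [set j | (k <= j)%N]) (iter j tau @^-1` A).
have mF k : measurable (F k).
  by apply: bigcup_measurable => j _; exact: measurable_preimage_iter.
have mI : measurable (\bigcap_k F k) by exact: bigcapT_measurable.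
have inv : tau @^-1` (\bigcap_k F k) = \bigcap_k F k.
  apply/seteqP; split => x h k _.
    have [j kj jx] := h k I; exists j.+1; first exact: leqW.
    by rewrite /preimage /= -iterS iterSr.
  have [[|j] kj jx] := h k.+1 I; first by [].
  by exists j => //; move: jx; rewrite /preimage /= -iterS iterSr.
have decr : {homo F : i j / (i <= j)%N >-> (j <= i)%O}.
  move=> i j ij; apply/subsetPset => x [l jl lx].
  by exists l => //; exact: leq_trans ij jl.
have FA k : (m A <= m (F k))%E.
  rewrite -(measure_preimage_iter _ _ tau_mp k _ mA) le_measure ?inE //.
    exact: measurable_preimage_iter.
  by move=> x Ax; exists k => //=.
have cvg := nonincreasing_cvg_mu
  (le_lt_trans (probability_le1 m (mF 0%N)) (ltry 1)) mF mI decr.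
have pos : (0 < m (\bigcap_k F k))%E.
  rewrite (lt_le_trans A0) // -(cvg_lim _ cvg) //.
  apply: lime_ge; first by apply/cvg_ex; exists (m (\bigcap_k F k)).
  by near=> k; exact: FA.
have [z|one] := erg _ mI inv; first by rewrite z ltxx in pos.
have mU : measurable (\bigcup_k (iter k tau @^-1` A)).
  by apply: bigcup_measurable => j _; exact: measurable_preimage_iter.
apply/eqP; rewrite eq_le probability_le1 //= -one le_measure ?inE //.
by move=> x /(_ 0%N I) [j _ jx]; exists j.
Unshelve. all: by end_near. Qed.

(** Take A of measure at most 2^(-L) and let B be the set of points that visit A for
the first time at time n, for some n >= L.  Along an orbit the time before the first
visit decreases by one at each step until A is reached, so two visits to B are
more than L steps apart.  Some such B has positive measure: the first L preimages
of A do not fill the space, but all preimages together do. *)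
Lemma tower_base L : nonatomic m -> ergodic m tau ->
  exists B, [/\ measurable B, (0 < m B)%E &
    forall x i j, (i < L)%N -> (j < L)%N ->
      B (iter i tau x) -> B (iter j tau x) -> i = j].
Proof.
move=> na erg; have [A [mA A0 AL]] := nonatomic_small m L na.
pose hit n := [set x | A (iter n tau x) /\
  forall i, (i < n)%N -> ~ A (iter i tau x)].
have hitE n : hit n = (iter n tau @^-1` A) `&`
    \bigcap_(i in [set i | (i < n)%N]) ~` (iter i tau @^-1` A).
  by apply/seteqP; split => x [].
have mhit n : measurable (hit n).
  rewrite hitE; apply: measurableI; first exact: measurable_preimage_iter.
  apply: bigcap_measurableType => i _.
  by apply: measurableC; exact: measurable_preimage_iter.
have [n Ln n0] : exists2 n, (L <= n)%N & (0 < m (hit n))%E.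
  apply: contrapT => none.
  have hit0 n : (L <= n)%N -> m (hit n) = 0%E.
    move=> Ln; apply/eqP; rewrite eq_le measure_ge0 andbT leNgt.
    by apply/negP => n0; apply: none; exists n.
  have cover : \bigcup_k (iter k tau @^-1` A) `<=`
      \big[setU/set0]_(k < L) (iter k tau @^-1` A) `|` \bigcup_k hit (L + k)%N.
    move=> x [k _ kx].
    have ex : exists k, `[< A (iter k tau x) >] by exists k; apply/asboolP.
    have [l /asboolP lx lmin] := ex_minnP ex.
    have [lL|Ll] := ltnP l L.
      by left; rewrite -(bigcup_mkord L (fun k => iter k tau @^-1` A)); exists l.
    right; exists (l - L)%N => //; rewrite subnKC //; split => // i il Ai.
    by have := lmin i (asboolT Ai); rewrite leqNgt il.
  have mU : measurable (\bigcup_k hit (L + k)%N) by exact: bigcupT_measurable.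
  have U0 : m (\bigcup_k hit (L + k)%N) = 0%E.
    apply: measure_negligible => //; apply: negligible_bigcup => k.
    by apply/(negligibleP m (mhit _)); apply: hit0; exact: leq_addr.
  have mV : measurable (\big[setU/set0]_(k < L) (iter k tau @^-1` A)).
    by apply: bigsetU_measurable => k _; exact: measurable_preimage_iter.
  have : (1 <= (L%:R * 2^-1 ^+ L : R)%:E)%E.
    rewrite -(ergodic_sweep A erg mA A0).
    rewrite (le_trans (le_measure _ _ _ cover)) ?inE //.
    - by apply: bigcupT_measurable => k; exact: measurable_preimage_iter.
    - exact: measurableU.
    apply: (le_trans (y := (m (\big[setU/set0]_(k < L) (iter k tau @^-1` A))
      + m (\bigcup_k hit (L + k)%N))%E)); first exact: measureU2.
    rewrite U0 adde0.
    apply: (le_trans (y := (\sum_(k < L) m (iter k tau @^-1` A))%E)).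
      apply: (Boole_inequality m (A := fun k => iter k tau @^-1` A)) => k _.
      exact: measurable_preimage_iter.
    rewrite (eq_bigr (fun=> m A)); last first.
      by move=> k _; exact: measure_preimage_iter.
    rewrite (le_trans (lee_sum _ (fun k _ => AL))) //.
    by rewrite sumEFin sumr_const card_ord mulr_natl.
  apply/negP; rewrite -ltNge lte_fin exprVn ltr_pdivrMr ?exprn_gt0 // mul1r.
  by rewrite -natrX ltr_nat ltn_expl.
exists (hit n); split => // x.
suff ordered i j : (i < j)%N -> (j < L)%N ->
    hit n (iter i tau x) -> hit n (iter j tau x) -> False.
  move=> i j iL jL hi hj.
  by have [ij|ji|//] := ltngtP i j; [case: (ordered i j)|case: (ordered j i)].
move=> ij jL [Ai _] [_ nj].
apply: (nj (n - (j - i))%N); first by lia.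
rewrite -iterD (_ : (n - (j - i) + j = n + i)%N); last by lia.
by rewrite iterD.
Qed.

(** On a tower of height L + K with base B, the function f that equals z^(-j) on the
j-th floor is an approximate eigenvector: p(U) f = p(z) f on the floors of index at
least K.  Comparing |f|^2 = (L + K) m(B) with |p(U) f|^2 >= |p(z)|^2 L m(B) and
letting L tend to infinity bounds |p(z)|. *)
Lemma polyact_bound_circle (p : {poly R[i]}) (C : R) :
  nonatomic m -> ergodic m tau -> 0 <= C ->
  (forall f, inL2 m f ->
     L2seminorm m (polyact tau p f) <= C * L2seminorm m f) ->
  forall z, cabs z = 1 -> cabs p.[z] <= C.
Proof.
move=> na erg C0 pC z z1; pose K := size p.
rewrite -(@ler_pXn2r _ 2) ?nnegrE ?cabs_ge0 //.
apply: (@le_of_mulr_natD _ _ _ (K%:R * C ^+ 2)) => L.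
have [B [mB B0 Bdisj]] := tower_base (L + K) na erg.
have z0 : z != 0.
  by apply/eqP => z0; move/eqP: z1; rewrite z0 cabs0 eq_sym oner_eq0.
have zV k : cabs (z ^- k) = 1.
  apply: complexI; rewrite cabsE normrV ?unitfE ?expf_neq0 // normrX -cabsE z1.
  by rewrite expr1n invr1.
pose g : X -> R[i] := fun x => (\1_B x)%:C%C.
have mg : cmeasurable g.
  by split => /=; [exact: measurable_indic|exact: measurable_cst].
have g2 x : cabs (g x) ^+ 2 = \1_B x.
  by rewrite cabs_real // indicE; case: (_ \in _); rewrite ?expr1n ?expr0n.
have intB k : (\int[m]_x (\1_B (iter k tau x))%:E = m B)%E.
  rewrite (ge0_integral_iter _ _ tau_mp k (fun x => (\1_B x)%:E)) //.
    by rewrite integral_indic // setIT.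
  by apply/measurable_EFinP; exact: measurable_indic.
have mBk k : measurable_fun setT (fun x => \1_B (iter k tau x) : R).
  apply: measurableT_comp; first exact: measurable_indic.
  exact: measurable_iter tau_mp k.
have g2y : (L2sq m g < +oo)%E.
  rewrite /L2sq; under eq_integral do rewrite g2.
  by rewrite (intB 0%N) (le_lt_trans (probability_le1 _ mB)) ?ltry.
have Lg : inL2 m g by apply/inL2P.
pose f := \sum_(j < L + K) z ^- j *: (g \o iter j tau).
have fE x : f x = \sum_(j < L + K) z ^- j * g (iter j tau x).
  by rewrite /f fct_sumE.
have Lf : inL2 m f.
  apply: (hs_mem_sum (L2_hilbert_seminorm m) g) => // j; apply: inL2Z.
  exact: inL2_iter.
have f_on x j : (j < L + K)%N -> B (iter j tau x) -> f x = z ^- j.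
  move=> jLK jB; rewrite fE (bigD1 (Ordinal jLK)) //= big1 => [|i ij].
    by rewrite addr0 /g indicE mem_set // mulr1.
  rewrite /g indicE memNset ?mulr0 // => iB.
  case/eqP: ij; apply/val_inj => /=.
  exact: (Bdisj x i j (ltn_ord i) jLK iB jB).
have pf_on x j : (K <= j)%N -> (j < L + K)%N -> B (iter j tau x) ->
    polyact tau p f x = p.[z] * z ^- j.
  move=> Kj jLK jB; rewrite /polyact /seqval horner_coef mulr_suml.
  apply: eq_bigr => i _; rewrite -mulrA; congr (_ * _).
  have ij : (i <= j)%N by rewrite ltnW // (leq_trans _ Kj).
  rewrite (f_on _ (j - i)%N); last by rewrite -iterD subnK.
    rewrite -{2}(subnK ij) exprD invfM mulrCA mulfV ?mulr1 // expf_neq0 //.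
  by rewrite (leq_ltn_trans (leq_subr _ _)).
have f2 x : cabs (f x) ^+ 2 <= \sum_(j < L + K) \1_B (iter j tau x).
  have S0 (P : pred 'I_(L + K)) :
      0 <= \sum_(j < L + K | P j) (\1_B (iter j tau x) : R).
    by apply: sumr_ge0 => j _; rewrite indicE.
  have [[j [jLK jB]]|none] :=
    pselect (exists j, (j < L + K)%N /\ B (iter j tau x)).
    rewrite (f_on x j) // zV expr1n (bigD1 (Ordinal jLK)) //= indicE mem_set //.
    by rewrite lerDl.
  rewrite fE big1 => [|j _]; first by rewrite cabs0 expr0n.
  rewrite /g indicE memNset ?mulr0 // => jB; apply: none; exists j.
  by split.
have pf2 x : cabs p.[z] ^+ 2 * \sum_(j < L) \1_B (iter (K + j) tau x)
    <= cabs (polyact tau p f x) ^+ 2.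
  have [[j [jL jB]]|none] :=
    pselect (exists j, (j < L)%N /\ B (iter (K + j) tau x)).
    have KjL : (K + j < L + K)%N by rewrite addnC ltn_add2r.
    rewrite (pf_on x (K + j)%N) ?leq_addr //.
    rewrite (bigD1 (Ordinal jL)) //= big1 => [|i ij].
      by rewrite addr0 indicE mem_set // mulr1 cabsM zV mulr1.
    rewrite indicE memNset // => iB; case/eqP: ij; apply/val_inj => /=.
    apply/(@addnI K); apply: (Bdisj x) => //.
    by rewrite addnC ltn_add2r.
  rewrite big1 ?mulr0 ?sqr_ge0 // => j _.
  by rewrite indicE memNset // => jB; apply: none; exists j.
set b := fine (m B).
have mBE : m B = b%:E by rewrite fineK // fin_num_measure.
have b0 : 0 < b by rewrite -lte_fin -mBE.
have intsum M c : (\int[m]_x (\sum_(j < M) \1_B (iter (c + j) tau x))%:E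
    = (M%:R * b)%:E)%E.
  under eq_integral do rewrite -sumEFin.
  rewrite ge0_integral_sum //.
  - rewrite (eq_bigr (fun=> b%:E)); last by move=> j _; rewrite intB.
    by rewrite sumEFin sumr_const card_ord mulr_natl.
  - by move=> j; apply/measurable_EFinP.
have msum M c : measurable_fun setT
    (fun x => \sum_(j < M) \1_B (iter (c + j) tau x) : R).
  by apply: measurable_sum => j.
have sum0 M c x : (0 <= (\sum_(j < M) (\1_B (iter (c + j) tau x) : R))%:E)%E.
  by rewrite lee_fin sumr_ge0 // => j _; rewrite indicE.
have Lp := inL2_polyact _ _ tau_mp p _ Lf.
have [mf _] := (inL2P _ _).1 Lf; have [mp _] := (inL2P _ _).1 Lp.
have lower : cabs p.[z] ^+ 2 * (L%:R * b) <= L2seminorm m (polyact tau p f) ^+ 2.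
  rewrite -lee_fin -L2sqE // EFinM -(intsum L K).
  rewrite -ge0_integralZl_EFin ?sqr_ge0 //; last first.
    exact/measurable_EFinP.
  apply: ge0_le_integral => //.
  - by move=> x _; rewrite mule_ge0 // lee_fin sqr_ge0.
  - by apply: measurable_funeM; exact/measurable_EFinP.
  - exact: emeasurable_sqr_cabs.
  - by move=> x _; rewrite -EFinM lee_fin; exact: pf2.
have upper : L2seminorm m f ^+ 2 <= (L + K)%:R * b.
  rewrite -lee_fin -L2sqE // -(intsum _ 0%N); apply: ge0_le_integral => //.
  - by move=> x _; rewrite lee_fin sqr_ge0.
  - exact: emeasurable_sqr_cabs.
  - exact/measurable_EFinP.
  - by move=> x _; rewrite lee_fin; exact: f2.
have mid : L2seminorm m (polyact tau p f) ^+ 2 <= C ^+ 2 * L2seminorm m f ^+ 2.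
  by rewrite -exprMn lerXn2r ?nnegrE ?mulr_ge0 ?L2seminorm_ge0 // pC.
rewrite -(ler_pM2r b0) -mulrDl -natrD.
have := le_trans lower (le_trans mid (ler_wpM2l (sqr_ge0 C) upper)).
by rewrite mulrCA mulrA [C ^+ 2 * _]mulrCA mulrA.
Qed.

End Tower.

(** * Unconditional convergence and the circle *)

Lemma horner_seqval {C : nzRingType} (p : {poly C}) (z : C) :
  p.[z] = seqval (fun k => z ^+ k) p.
Proof. exact: horner_coef. Qed.

Lemma horner_circle_bounded {R : realType} (p : {poly R[i]}) :
  exists B, forall z, cabs z = 1 -> cabs p.[z] <= B.
Proof.
exists (\sum_(i < size p) cabs p`_i) => z z1; rewrite horner_coef.
rewrite (le_trans (cabs_sum _ _ _ _)) // ler_sum // => i _.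
rewrite cabsM (_ : cabs (z ^+ i) = 1) ?mulr1 //.
by apply: complexI; rewrite cabsE normrX -cabsE z1 expr1n.
Qed.

Lemma sum_norm_le_subsums {R : realType} (a : nat -> R) (B : R) N :
  (forall S : pred nat, `|\sum_(0 <= k < N | S k) a k| <= B) ->
  \sum_(0 <= k < N) `|a k| <= 2 * B.
Proof.
move=> aB; rewrite (bigID (fun k => 0 <= a k)) /= mulr2n mulrDl mul1r lerD //.
  rewrite (eq_bigr a) => [|k a0]; last by rewrite ger0_norm.
  exact: le_trans (ler_norm _) (aB _).
rewrite (eq_bigr (fun k => - a k)) => [|k a0]; last first.
  by rewrite ltr0_norm // ltNge.
by rewrite sumrN (le_trans _ (aB (fun k => ~~ (0 <= a k)))) // -normrN ler_norm.
Qed.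

(** Subsums over the indices where the real, respectively imaginary, part has a
given sign: four subsums, each at most B. *)
Lemma sum_cabs_le_subsums {R : realType} (a : nat -> R[i]) (B : R) N :
  (forall S : pred nat, cabs (\sum_(0 <= k < N | S k) a k) <= B) ->
  \sum_(0 <= k < N) cabs (a k) <= 4 * B.
Proof.
move=> aB; have cabs_le z : cabs z <= `|complex.Re z| + `|complex.Im z| :> R.
  rewrite -(@ler_pXn2r _ 2) ?nnegrE ?cabs_ge0 ?addr_ge0 // sqr_cabs.
  rewrite sqrrD !real_normK ?num_real // addrAC lerDl.
  by rewrite mulrn_wge0 // mulr_ge0.
have part (P : R[i] -> R) : (forall y z, P (y + z) = P y + P z) ->
    (forall z, `|P z| <= cabs z) -> \sum_(0 <= k < N) `|P (a k)| <= 2 * B.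
  move=> PD Pc; have P0 : P 0 = 0 by apply: (addrI (P 0)); rewrite -PD !addr0.
  apply: sum_norm_le_subsums => S; rewrite -(big_morph P PD P0).
  exact: le_trans (Pc _) (aB S).
rewrite (le_trans (ler_sum _ (fun k _ => cabs_le _))) // big_split /=.
have -> : 4 * B = 2 * B + 2 * B by ring.
rewrite lerD // part //; do ?[exact: cabs_ge_Re|exact: cabs_ge_Im].
  by move=> [? ?] [].
by move=> [? ?] [].
Qed.

Lemma sum_injective_le {R : realType} (a : nat -> R) (B : R) (pi : nat -> nat) N :
  (forall k, 0 <= a k) -> (forall M, \sum_(0 <= k < M) a k <= B) ->
  injective pi -> \sum_(0 <= k < N) a (pi k) <= B.
Proof.
move=> a0 aB pi_inj; pose s := map pi (iota 0 N).
have us : uniq s by rewrite map_inj_uniq ?iota_uniq.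
pose M := (\max_(x <- s) x).+1.
have sM : perm_eq s (seq.filter (mem s) (iota 0 M)).
  apply: uniq_perm => // [|x]; first by rewrite filter_uniq ?iota_uniq.
  rewrite mem_filter mem_iota /= add0n; apply/idP/andP => [xs|[]//].
  by split => //; rewrite ltnS; exact: leq_bigmax_seq.
apply: le_trans (aB M); rewrite /index_iota !subn0 -(big_map pi xpredT).
rewrite (perm_big _ sM) big_filter big_mkcond ler_sum // => k _.
by case: ifP.
Qed.

Definition average_poly (R : realType) (n : nat) : {poly R[i]} :=
  n%:R^-1 *: \sum_(1 <= k < n.+1) 'X^k.
Arguments average_poly {R} n.

Lemma power_averageE {R : realType} n (z : R[i]) :
  power_average n z = (average_poly n).[z].
Proof.
rewrite horner_seqval seqvalZ seqval_sum; congr (_ * _).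
by apply: eq_bigr => k _; rewrite seqvalXn.
Qed.

Lemma ergodic_averageE {X : Type} {R : realType} (tau : X -> X) n (f : X -> R[i]) :
  ergodic_average tau n f = polyact tau (average_poly n) f.
Proof.
apply/funext => x; rewrite /polyact seqvalZ seqval_sum; congr (_ * _).
by apply: eq_bigr => k _; rewrite seqvalXn.
Qed.

Lemma polyact_sumZ {X : Type} {R : realType} (tau : X -> X) (f : X -> R[i]) I
    (r : seq I) (S : pred I) (c : I -> R[i]) (p : I -> {poly R[i]}) :
  polyact tau (\sum_(i <- r | S i) c i *: p i) f
    = \sum_(i <- r | S i) c i *: polyact tau (p i) f.
Proof.
apply/funext => x; rewrite /polyact seqval_sum fct_sumE.
by apply: eq_bigr => i _; rewrite seqvalZ.
Qed.

Lemma polyact_sum {X : Type} {R : realType} (tau : X -> X) (f : X -> R[i]) I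
    (r : seq I) (S : pred I) (p : I -> {poly R[i]}) :
  polyact tau (\sum_(i <- r | S i) p i) f = \sum_(i <- r | S i) polyact tau (p i) f.
Proof.
apply/funext => x; rewrite /polyact seqval_sum fct_sumE.
exact: eq_bigr.
Qed.

Lemma L2_convergent_seriesP {d} {X : measurableType d} {R : realType}
    (m : {measure set X -> \bar R}) (u : nat -> X -> R[i]) :
  (forall k, inL2 m (u k)) ->
  L2_convergent_series m u <->
  seminorm_cauchy (L2seminorm m) (fun N => \sum_(0 <= k < N) u k).
Proof.
move=> Lu; pose H := L2_hilbert_seminorm m; pose S N := \sum_(0 <= k < N) u k.
have LS N : inL2 m (S N) by exact: (hs_mem_sum H (u 0%N)).
have normE g N : inL2 m g -> L2norm m (fun x => \sum_(0 <= k < N) u k x - g x)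
    = (L2seminorm m (S N - g))%:E.
  move=> Lg; rewrite -L2normE; last by have /inL2P[] := hs_memB H _ _ (LS N) Lg.
  by congr L2norm; apply/funext => x; rewrite /S !fctE fct_sumE.
split=> [[g Lg cvg] e e0|cau].
  have e2 : 0 < e / 2 by rewrite divr_gt0.
  move: cvg; under eq_fun do rewrite normE //.
  move=> /fine_cvgP[_ /cvgrPdist_le /(_ _ e2)[N _ NP]].
  have {}NP i : (N <= i)%N -> L2seminorm m (S i - g) <= e / 2.
    by move=> /NP /=; rewrite sub0r normrN ger0_norm // L2seminorm_ge0.
  exists N => i j Ni ij; rewrite -/(S i) -/(S j) -(subrK g (S j)) -addrA.
  have [Ljg Lig] := (hs_memB H _ _ (LS j) Lg, hs_memB H _ _ (LS i) Lg).
  have Lgi := hs_memB H _ _ Lg (LS i).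
  rewrite (le_trans (hs_normD H _ _ Ljg Lgi)) //.
  by rewrite -(hs_normN H _ Lgi) opprB [leRHS]splitr lerD // NP // (leq_trans Ni).
have [g Lg gP] := L2_complete m S LS cau; exists g => //.
under eq_fun do rewrite normE //.
apply: cvg_EFin; first by near=> N.
apply/cvgrPdist_le => e e0; have [N NP] := gP e e0.
exists N => // i /NP /= le; rewrite sub0r normrN ger0_norm //.
exact: L2seminorm_ge0.
Unshelve. all: by end_near. Qed.

Section Averages.
Context {d} {X : measurableType d} {R : realType}.
Variables (m : probability X R) (tau : X -> X).
Hypothesis tau_mp : measure_preserving m tau.

(** With |c_k| <= 1, the polynomial sum of c_k p_(pi k) is bounded by B on the
circle for every permutation pi, so the von Neumann inequality bounds all the
multiplied sums of a rearranged series. *)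
Lemma unconditional_of_circle_bound (p : nat -> {poly R[i]}) (B : R) :
  (forall z, cabs z = 1 -> forall N, \sum_(0 <= k < N) cabs (p k).[z] <= B) ->
  forall f, inL2 m f ->
    L2_unconditionally_convergent m (fun k => polyact tau (p k) f).
Proof.
move=> pB f Lf pi pi_bij; have Lp k := inL2_polyact _ _ tau_mp (p k) _ Lf.
apply/L2_convergent_seriesP => [k|]; first exact: Lp.
apply: (bounded_multipliers_cauchy (L2_hilbert_seminorm m) _
  (B * L2seminorm m f)) => [k|N c c1]; first exact: Lp.
rewrite -(polyact_sumZ tau f _ _ _ c (p \o pi)).
apply: von_neumann_inequality => // z z1; rewrite horner_sum.
rewrite (le_trans (cabs_sum _ _ _ _)) //.
apply: (@le_trans _ _ (\sum_(0 <= k < N) cabs (p (pi k)).[z])).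
  by apply: ler_sum => k _; rewrite hornerZ cabsM ler_piMl ?cabs_ge0.
apply: (sum_injective_le (fun k => cabs (p k).[z])) (pB z z1) _.
  by move=> k; exact: cabs_ge0.
exact: bij_inj.
Qed.

(** Uniform boundedness is applied to the family of all finite subsums, indexed by a
length and a predicate on indices. *)
Lemma circle_bound_of_unconditional (p : nat -> {poly R[i]}) :
  nonatomic m -> ergodic m tau ->
  (forall f, inL2 m f ->
    L2_unconditionally_convergent m (fun k => polyact tau (p k) f)) ->
  exists B, forall z, cabs z = 1 ->
    forall N, \sum_(0 <= k < N) cabs (p k).[z] <= B.
Proof.
move=> na erg uc; pose H := L2_hilbert_seminorm m.
pose part (i : nat * pred nat) := \sum_(0 <= k < i.1 | i.2 k) p k.
have [|||||B B0 TB] := @uniform_boundedness _ _ _ _ H _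
    (fun i => polyact tau (part i)) _ (L2_complete m).
- exists 0; apply/inL2P; split.
    by split => /=; exact: measurable_cst.
  rewrite /L2sq; under eq_integral do rewrite cabs0 expr0n.
  by rewrite integral0.
- by move=> i c f g; exact: polyact_linear.
- by move=> i f Lf; exact: inL2_polyact.
- move=> i; have [B pB] := horner_circle_bounded (part i).
  by exists B => f Lf; exact: von_neumann_inequality.
- move=> f Lf; have Lp k := inL2_polyact _ _ tau_mp (p k) _ Lf.
  have [pi bij|B Bsub] := unconditional_bounded_subsums H _ Lp.
    by apply/L2_convergent_seriesP => //; exact: uc.
  by exists B => i; rewrite polyact_sum.
exists (4 * B) => z z1 N; apply: sum_cabs_le_subsums => S.
rewrite -horner_sum -/(part (N, S)).
by apply: (polyact_bound_circle _ _ tau_mp) z1 => // f; exact: TB.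
Qed.

End Averages.

Theorem theorem3p1 (R : realType) (d : measure_display) (X : measurableType d)
    (m : probability X R) (m_nonatomic : nonatomic m)
    (tau : X -> X) (tau_mp : measure_preserving m tau)
    (tau_ergodic : ergodic m tau)
    (n : nat -> nat) (n_gt0 : forall k, (0 < n k)%N)
    (n_nondecr : forall i j, (i <= j)%N -> (n i <= n j)%N) :
  (forall f : X -> R[i], inL2 m f ->
     L2_unconditionally_convergent m
       (fun k x => ergodic_average tau (n k.+1) f x
                   - ergodic_average tau (n k) f x))
  <->
  (ereal_sup
     [set (\sum_(0 <= k <oo)
             (cabs (power_average (n k.+1) gamma
                    - power_average (n k) gamma)%R)%:E)%E
     | gamma in [set z : R[i] | cabs z = 1%R]] < +oo)%E.
Proof.
pose p k : {poly R[i]} := average_poly (n k.+1) - average_poly (n k).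
have pE f : (fun k x => ergodic_average tau (n k.+1) f x
    - ergodic_average tau (n k) f x) = fun k => polyact tau (p k) f.
  apply/funext => k; rewrite !ergodic_averageE; apply/funext => x.
  by rewrite /polyact /p seqvalB.
have hornerE k (z : R[i]) :
    power_average (n k.+1) z - power_average (n k) z = (p k).[z].
  by rewrite !power_averageE /p hornerD hornerN.
pose a z k : \bar R :=
  (cabs (power_average (n k.+1) z - power_average (n k) z)%R)%:E.
have a0 z k : (0 <= a z k)%E by rewrite lee_fin cabs_ge0.
have aE z N : (\sum_(0 <= k < N) a z k)%E
    = (\sum_(0 <= k < N) cabs (p k).[z])%:E.
  by rewrite -sumEFin; apply: eq_bigr => k _; rewrite /a hornerE.
split=> [uc|fin f Lf].
  have [f Lf|B pB] :=
    circle_bound_of_unconditional _ _ tau_mp p m_nonatomic tau_ergodic.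
    by have := uc f Lf; rewrite pE.
  apply: (@le_lt_trans _ _ B%:E); last exact: ltry.
  apply: ge_ereal_sup => _ [z /= z1 <-].
  apply: (lime_le (f := fun N => (\sum_(0 <= k < N) a z k)%E)).
    by apply: is_cvg_nneseries => k _ _.
  by near=> N; rewrite aE lee_fin pB.
rewrite pE; set s := ereal_sup _ in fin.
have sB z : cabs z = 1 -> forall N, ((\sum_(0 <= k < N) cabs (p k).[z])%:E <= s)%E.
  move=> z1 N; rewrite -aE.
  apply: le_trans (nneseries_lim_ge N (fun k _ _ => a0 z k)) _.
  by apply: ereal_sup_ubound; exists z.
apply: (unconditional_of_circle_bound _ _ tau_mp p (fine s)) => // z z1 N.
rewrite -lee_fin fineK ?sB // ge0_fin_numE //.
by have := sB 1 cabs1 0%N; rewrite big_nil.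
Unshelve. all: by end_near. Qed.
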